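(* Let $\mathcal{M}$ be an $\omega$-categorical structure. Suppose every group definable in $\mathcal{M}$ has a connected component and every ring interpretable in $\mathcal{M}$ is nilpotent-by-finite (it suffices that every commutative ring interpretable in $\mathcal{M}$ is nilpotent-by-finite). Then every solvable group definable in $\mathcal{M}$ is nilpotent-by-finite.
   Context: A structure in a countable language is $\omega$-categorical if its theory has, up to isomorphism, exactly one countable model. Definable means definable with parameters; interpretable means definable in $\mathcal{M}^{eq}$. A group $H$ definable in $\mathcal{M}$ has a connected component if there is a smallest subgroup of finite index among the definable subgroups of $H$ of finite index. Rings are associative, not necessarily unital. A ring is nilpotent-by-finite if it has a nilpotent ideal of finite index; a group is nilpotent-by-finite if it has a normal nilpotent subgroup of finite index. *)

(* Defs.v *)
From HB Require Import structures.
From mathcomp Require Import all_boot all_order all_algebra.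
From mathcomp Require Import boolp classical_sets functions cardinality.

Set Implicit Arguments.
Unset Strict Implicit.
Unset Printing Implicit Defensive.

Local Open Scope classical_set_scope.

(** * Many-sorted first-order logic

    Sorts are needed only for [M^eq]; the structures the theorem is about are
    one-sorted, see [signature]. *)

Record language := Language {
  sorts : Type;
  fsym : Type;
  far  : fsym -> nat;
  fdom : forall f, 'I_(far f) -> sorts;
  fcod : fsym -> sorts;
  rsym : Type;
  rar  : rsym -> nat;
  rdom : forall r, 'I_(rar r) -> sorts
}.
Arguments fdom : clear implicits.
Arguments fcod : clear implicits.
Arguments rdom : clear implicits.

Record structure (L : language) := Structure {
  carrier :> sorts L -> Type;
  carrier_inhabited : forall s, inhabited (carrier s);
  fint : forall f, (forall i, carrier (fdom L f i)) -> carrier (fcod L f);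
  rint : forall r, (forall i, carrier (rdom L r i)) -> Prop
}.

Arguments fint {L} M f a : rename.
Arguments rint {L} M r a : rename.

(** A context is a family [w : I -> sorts L]: the variables are the elements of
    [I], and [w i] is the sort of [i]. *)

Definition ext {L : language} {I : Type} (w : I -> sorts L) (s : sorts L)
  : option I -> sorts L :=
  fun o => if o is Some i then w i else s.

Inductive term (L : language) (I : Type) (w : I -> sorts L) : sorts L -> Type :=
| Var (i : I) : term w (w i)
| App (f : fsym L) (t : forall i, term w (fdom L f i)) : term w (fcod L f).

Inductive formula (L : language) (I : Type) (w : I -> sorts L) : Type :=
| Bot
| Equal (s : sorts L) (t u : term w s)
| Rel (r : rsym L) (t : forall i, term w (rdom L r i))
| Imp (p q : formula w)
| All (s : sorts L) (p : formula (ext w s)).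

Section Semantics.
Variables (L : language) (M : structure L).

Definition tup (I : Type) (w : I -> sorts L) := forall i, M (w i).

Definition ext_tuple (I : Type) (w : I -> sorts L) (a : tup w)
    (s : sorts L) (x : M s) : tup (ext w s) :=
  fun o => match o return M (ext w s o) with Some i => a i | None => x end.

Fixpoint eval (I : Type) (w : I -> sorts L) (a : tup w) (s : sorts L)
    (t : term w s) : M s :=
  match t with
  | Var i => a i
  | App f t => fint M f (fun i => eval a (t i))
  end.

Fixpoint sat (I : Type) (w : I -> sorts L) (p : formula w)
    : tup w -> Prop :=
  match p with
  | Bot => fun=> False
  | Equal _ t u => fun a => eval a t = eval a u
  | Rel r t => fun a => rint M r (fun i => eval a (t i))
  | Imp p q => fun a => sat p a -> sat q a
  | All s p => fun a => forall x : M s, sat p (ext_tuple a x)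
  end.

Definition pair_ctx (I J : Type) (v : I -> sorts L) (w : J -> sorts L)
  : I + J -> sorts L :=
  fun k => match k with inl i => v i | inr j => w j end.

Definition pair_tuple (I J : Type) (v : I -> sorts L) (w : J -> sorts L)
    (a : tup v) (b : tup w) : tup (pair_ctx v w) :=
  fun k => match k return M (pair_ctx v w k) with
           | inl i => a i | inr j => b j end.

(** Definability with parameters: [b] is the tuple of parameters. *)
Definition definable (I : finType) (w : I -> sorts L) (A : set (tup w)) :=
  exists (m : nat) (v : 'I_m -> sorts L) (b : tup v)
         (p : formula (pair_ctx w v)),
    A = [set a | sat p (pair_tuple a b)].

Definition sentence := formula (of_void (sorts L)).

Definition holds (p : sentence) : Prop :=
  sat p (fun i : void => match i with end).

(** The parameter-free definable equivalence relations on finite products of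
    sorts. *)
Record eqrel := Eqrel {
  er_arity : nat;
  er_ctx : 'I_er_arity -> sorts L;
  er_formula : formula (pair_ctx er_ctx er_ctx);
  er_rel : tup er_ctx -> tup er_ctx -> Prop :=
    fun a b => sat er_formula (pair_tuple a b);
  er_refl : forall a, er_rel a a;
  er_sym : forall a b, er_rel a b -> er_rel b a;
  er_trans : forall a b c, er_rel a b -> er_rel b c -> er_rel a c
}.

Arguments er_ctx : clear implicits.

Definition er_quotient (E : eqrel) :=
  {c : set (tup (er_ctx E)) | exists a, c = er_rel a}.

Definition er_class (E : eqrel) (a : tup (er_ctx E))
  : er_quotient E :=
  exist _ (er_rel a) (ex_intro _ a erefl).

(** ** [M^eq]

    The sorts are those of [M] (left summand) and one sort for each [E] in
    [eqrel], interpreted as the set of [E]-classes; the language is extended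
    with the projection onto the [E]-classes, for each [E]. *)
Definition meq_fdom (f : fsym L + eqrel)
  : 'I_(match f with inl f => far f | inr E => er_arity E end) ->
    sorts L + eqrel :=
  match f with
  | inl f => fun i => inl (fdom L f i)
  | inr E => fun i => inl (er_ctx E i)
  end.

Definition meq_language : language := {|
  sorts := sorts L + eqrel;
  fsym := fsym L + eqrel;
  fdom := meq_fdom;
  fcod := fun f => match f with inl f => inl (fcod L f) | inr E => inr E end;
  rsym := rsym L;
  rdom := fun r i => inl (rdom L r i)
|}.

Definition meq_carrier (s : sorts meq_language) : Type :=
  match s with inl s => M s | inr E => er_quotient E end.

Lemma meq_inhabited s : inhabited (meq_carrier s).
Proof.
case: s => [s|E] /=; first exact: carrier_inhabited.
suff [a] : inhabited (tup (er_ctx E)).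
  exact: inhabits (er_class a).
have h i : {x : M (er_ctx E i) | True}.
  by apply: cid; case: (carrier_inhabited M (er_ctx E i)) => x; exists x.
exact: inhabits (fun i => sval (h i)).
Qed.

Definition meq_fint (f : fsym meq_language)
  : (forall i, meq_carrier (fdom meq_language f i)) ->
    meq_carrier (fcod meq_language f) :=
  match f with
  | inl f => fint M f
  | inr E => @er_class E
  end.

Definition meq : structure meq_language := {|
  carrier := meq_carrier;
  carrier_inhabited := meq_inhabited;
  fint := meq_fint;
  rint := rint M
|}.

End Semantics.

(** * Omega-categoricity *)

(** Countable one-sorted languages. *)
Record signature := Signature {
  sg_fun : countType;
  sg_far : sg_fun -> nat;
  sg_rel : countType;
  sg_rar : sg_rel -> nat
}.

Definition one_sorted (S : signature) : language := {|
  sorts := unit;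
  fsym := sg_fun S;
  far := @sg_far S;
  fdom := fun _ _ => tt;
  fcod := fun=> tt;
  rsym := sg_rel S;
  rar := @sg_rar S;
  rdom := fun _ _ => tt
|}.
Coercion one_sorted : signature >-> language.

Definition isomorphic (L : language) (M N : structure L) :=
  exists h : forall s, M s -> N s,
    [/\ forall s, bijective (h s),
        forall f a, h _ (fint M f a) = fint N f (fun i => h _ (a i))
      & forall r a, rint M r a <-> rint N r (fun i => h _ (a i))].

Definition model_of_theory (L : language) (M N : structure L) :=
  forall p : sentence L, holds M p -> holds N p.

(** [countable] includes finite: the theory of an infinite structure has only
    infinite models, and a finite structure is omega-categorical. *)
Definition countable_structure (L : language) (M : structure L) :=
  forall s, countable [set: M s].

Definition omega_categorical (S : signature) (M : structure S) :=
  exists N : structure S,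
    [/\ countable_structure N, model_of_theory M N
      & forall N' : structure S,
          countable_structure N' -> model_of_theory M N' -> isomorphic N N'].

(** * Groups *)

Section Groups.
Variable G : groupType.
Local Open Scope group_scope.
Implicit Types A B H K : set G.

Definition subgroup H :=
  [/\ H 1, forall x y, H x -> H y -> H (x * y) & forall x, H x -> H x^-1].

Definition group_normal H := forall x y, H x -> H (x ^ y).

Definition finite_index H := finite_set (range (fun x => [set x * h | h in H])).

(** The subgroup generated by the commutators of elements of [A] with elements
    of [B]. *)
Definition commutator_subgroup A B : set G :=
  smallest subgroup [set [~ x, y] | x in A & y in B].

Fixpoint lower_central (H : set G) (k : nat) : set G :=
  if k is k'.+1 then commutator_subgroup (lower_central H k') H else H.

Fixpoint derived_series (H : set G) (k : nat) : set G :=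
  if k is k'.+1 then
    commutator_subgroup (derived_series H k') (derived_series H k')
  else H.

Definition group_nilpotent H := exists k, lower_central H k = [set 1].

Definition group_solvable := exists k, derived_series [set: G] k = [set 1].

Definition group_nilpotent_by_finite :=
  exists H, [/\ subgroup H, group_normal H, group_nilpotent H & finite_index H].

End Groups.

(** * Rings, associative but not necessarily unital *)

Record rng := Rng {
  rng_zmod :> zmodType;
  rng_mul : rng_zmod -> rng_zmod -> rng_zmod;
  rng_mulA : associative rng_mul;
  rng_mulDl : left_distributive rng_mul +%R;
  rng_mulDr : right_distributive rng_mul +%R
}.

Section Rings.
Variable R : rng.
Local Open Scope ring_scope.
Implicit Type J : set R.

Definition ideal J :=
  [/\ J 0, forall x y, J x -> J y -> J (x - y)
    & forall r x, J x -> J (rng_mul r x) /\ J (rng_mul x r)].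

(** The set of products of [k.+1] elements of [J]. *)
Fixpoint products J (k : nat) : set R :=
  if k is k'.+1 then [set rng_mul x y | x in products J k' & y in J] else J.

Definition nilpotent_ideal J := exists k, products J k `<=` [set 0].

Definition additive_finite_index J :=
  finite_set (range (fun x => [set x + y | y in J])).

Definition rng_nilpotent_by_finite :=
  exists J, [/\ ideal J, nilpotent_ideal J & additive_finite_index J].

Definition rng_commutative := commutative (@rng_mul R).

End Rings.

(** * Definable groups and rings

    The underlying set is identified, through an injection, with a definable
    subset of a finite product of sorts (a power of [M] if [M] is one-sorted),
    in such a way that the graphs of the operations are definable. *)

Definition graph2 (L : language) (M : structure L) (I : Type) (w : I -> sorts L)
    (T : Type) (emb : T -> tup M w) (op : T -> T -> T)
  : set (tup M (pair_ctx (pair_ctx w w) w)) :=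
  [set c | exists x y,
     c = pair_tuple (pair_tuple (emb x) (emb y)) (emb (op x y))].

Record definable_group (L : language) (M : structure L) := DefinableGroup {
  dg_group :> groupType;
  dg_dim : nat;
  dg_ctx : 'I_dg_dim -> sorts L;
  dg_emb : dg_group -> tup M dg_ctx;
  dg_inj : injective dg_emb;
  dg_range : definable (range dg_emb);
  dg_mul : definable (graph2 dg_emb (fun x y => x * y)%g)
}.

Record definable_ring (L : language) (M : structure L) := DefinableRing {
  dr_rng :> rng;
  dr_dim : nat;
  dr_ctx : 'I_dr_dim -> sorts L;
  dr_emb : dr_rng -> tup M dr_ctx;
  dr_inj : injective dr_emb;
  dr_range : definable (range dr_emb);
  dr_add : definable (graph2 dr_emb (fun x y => x + y)%R);
  dr_mul : definable (graph2 dr_emb (@rng_mul dr_rng))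
}.

Definition interpretable_ring (L : language) (M : structure L) :=
  definable_ring (meq M).

Definition definable_subset (L : language) (M : structure L)
    (G : definable_group M) (H : set G) :=
  definable (@dg_emb _ _ G @` H).

Definition has_connected_component (L : language) (M : structure L)
    (G : definable_group M) :=
  exists H : set G,
    [/\ subgroup H, definable_subset H, finite_index H
      & forall K : set G, subgroup K -> definable_subset K -> finite_index K ->
          H `<=` K].

(* Main.v *)
(** The commutator subgroups, the lower central series and the hypercentral
    series below are increasing unions of sets defined by formulas in the same
    finitely many variables and parameters, so by the Ryll-Nardzewski theorem
    they are definable.

    It suffices to show, by induction on the derived length, that a connected
    definable solvable group [H] is nilpotent. If [N] is the connected component
    of [[H, H]], the centralizer of an element of [H] modulo [N] has finite
    index, so [[H, H] = N] is connected, hence nilpotent. Let [A / B] be a factor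
    of the lower central series of [[H, H]]; [H] acts on it through an abelian
    group. For [a] in [A], the orbit of [a] under the augmentation ideal of the
    ring of operators generated by [H] is an interpretable commutative ring, with
    product [(r a) (s a) = r s a]. It has a nilpotent ideal of finite index, so a
    subset of [H] with finitely many translates acts unipotently on [a];
    applying connectedness to the stabilizers, which are definable, so does [H].
    Omega-categoricity makes the nilpotency degree uniform in [a], and [H] is
    nilpotent. *)

From HB Require Import structures.
From mathcomp Require Import all_boot all_order all_algebra.
From mathcomp Require Import boolp classical_sets functions cardinality filter.
Require Import Defs.

Set Implicit Arguments.
Unset Strict Implicit.
Unset Printing Implicit Defensive.

Import GRing.Theory.

Local Open Scope classical_set_scope.

(** * Substitution and parameter-free definability *)

Section Substitution.
Variables (L : language) (M : structure L).

(** Omega-categoricity enters only through [formula_cover]: countably many sets defined by formulas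
    in one finite tuple of variables have the same union as finitely many of them. Parameters count
    among these variables, so they must be common to the whole family; hence definability is handled
    over a fixed tuple [b], enlarged whenever a new parameter is needed. As [M] may be uncountable,
    the cover is found in the countable model [N]: its uniqueness forces it both to realize every
    finitely satisfiable sequence of formulas and to be atomic, and the two properties together give
    the finite cover. The ring lives on the orbit of [a] because an operator that is a sum of [k]
    differences takes [2k] group elements to describe, with [k] unbounded, whereas its value at [a]
    is one element. As the operators commute, this value determines the operator on the orbit, which
    makes the product well defined. Differences of operators are used because [[~ x, g]] is
    [(g - 1) x] in additive notation: nilpotency in the ring becomes vanishing of iterated
    commutators. *)

Fixpoint tsub I (w : I -> sorts L) J (w' : J -> sorts L)
    (e : forall i, term w' (w i)) s (t : term w s) : term w' s :=
  match t with
  | Var i => e i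
  | App f t => App (fun i => tsub e (t i))
  end.

Definition sub_ext I (w : I -> sorts L) J (w' : J -> sorts L)
    (e : forall i, term w' (w i)) s (o : option I)
  : term (ext w' s) (ext w s o) :=
  match o return term (ext w' s) (ext w s o) with
  | Some i => tsub (fun j => Var (ext w' s) (Some j)) (e i)
  | None => Var (ext w' s) None
  end.

Fixpoint fsub I (w : I -> sorts L) (p : formula w)
  : forall J (w' : J -> sorts L), (forall i, term w' (w i)) -> formula w' :=
  match p with
  | Bot => fun J w' e => Bot w'
  | Equal _ t u => fun J w' e => Equal (tsub e t) (tsub e u)
  | Rel r t => fun J w' e => Rel (fun i => tsub e (t i))
  | Imp p q => fun J w' e => Imp (fsub p e) (fsub q e)
  | All s p => fun J w' e => All (fsub p (sub_ext e s))
  end.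

Lemma eval_tsub I (w : I -> sorts L) J (w' : J -> sorts L)
    (e : forall i, term w' (w i)) (a : tup M w') s (t : term w s) :
  eval a (tsub e t) = eval (fun i => eval a (e i)) t.
Proof.
elim: t => //= f t IH; congr (fint M f).
by apply: functional_extensionality_dep.
Qed.

Lemma sat_fsub I (w : I -> sorts L) (p : formula w) J (w' : J -> sorts L)
    (e : forall i, term w' (w i)) (a : tup M w') :
  sat (fsub p e) a <-> sat p (fun i => eval a (e i)).
Proof.
elim: p J w' e a => {I w} [I w|I w s t u|I w r t|I w p IHp q IHq|I w s p IH] J w' e a //=.
- by rewrite !eval_tsub.
- rewrite (_ : (fun i => _) = (fun i => eval (fun i => eval a (e i)) (t i))) //.
  by apply: functional_extensionality_dep => i; rewrite eval_tsub.
- by rewrite IHp IHq.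
- have E (x : M s) : (fun o => eval (ext_tuple a x) (sub_ext e s o)) =
             ext_tuple (fun i => eval a (e i)) x.
    by apply: functional_extensionality_dep; case=> //= i; rewrite eval_tsub.
  by split=> h x; have := h x; rewrite IH E.
Qed.

(** Definability without parameters is a property of predicates here, so that formulas are obtained
    from closure properties and hardly ever written out. *)
Definition foset I (w : I -> sorts L) (A : tup M w -> Prop) :=
  exists p : formula w, forall a, sat p a <-> A a.

Lemma foset_iff I (w : I -> sorts L) (A B : tup M w -> Prop) :
  foset A -> (forall a, A a <-> B a) -> foset B.
Proof. by case=> p hp h; exists p => a; rewrite hp h. Qed.

Lemma foset_sat I (w : I -> sorts L) (p : formula w) : foset (sat (M := M) p).
Proof. by exists p. Qed.

Lemma foset_sub I (w : I -> sorts L) J (w' : J -> sorts L)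
    (e : forall i, term w' (w i)) (A : tup M w -> Prop) :
  foset A -> foset (fun a => A (fun i => eval a (e i))).
Proof. by case=> p hp; exists (fsub p e) => a; rewrite sat_fsub hp. Qed.

Lemma foset_eq I (w : I -> sorts L) s (t u : term w s) :
  foset (fun a => eval a t = eval a u).
Proof. by exists (Equal t u). Qed.

Lemma foset_false I (w : I -> sorts L) : foset (fun _ : tup M w => False).
Proof. by exists (Bot w). Qed.

Lemma foset_imp I (w : I -> sorts L) (A B : tup M w -> Prop) :
  foset A -> foset B -> foset (fun a => A a -> B a).
Proof. by case=> p hp [q hq]; exists (Imp p q) => a /=; rewrite hp hq. Qed.

Lemma foset_not I (w : I -> sorts L) (A : tup M w -> Prop) :
  foset A -> foset (fun a => ~ A a).
Proof. by move=> hA; apply: foset_imp hA (foset_false w). Qed.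

Lemma foset_and I (w : I -> sorts L) (A B : tup M w -> Prop) :
  foset A -> foset B -> foset (fun a => A a /\ B a).
Proof.
move=> hA hB; apply: foset_iff (foset_not (foset_imp hA (foset_not hB))) _ => a.
split=> [h|[hA' hB'] h]; last exact: h.
by split; apply: contrapT => h'; apply: h => // ?.
Qed.

Lemma foset_all I (w : I -> sorts L) s (A : tup M (ext w s) -> Prop) :
  foset A -> foset (fun a => forall x : M s, A (ext_tuple a x)).
Proof. by case=> p hp; exists (All p) => a; split=> h x; apply/hp/h. Qed.

Lemma foset_forall_fin (K : finType) I (w : I -> sorts L)
    (A : K -> tup M w -> Prop) :
  (forall k, foset (A k)) -> foset (fun a => forall k, A k a).
Proof.
move=> hA.
have h (s : seq K) : foset (fun a => forall k, k \in s -> A k a).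
  elim: s => [|k s IH].
    by apply: foset_iff (foset_not (foset_false w)) _ => a; split=> [_ k|_ []]; rewrite ?in_nil.
  apply: foset_iff (foset_and (hA k) IH) _ => a; split.
    by case=> h1 h2 j; rewrite inE => /predU1P[->|/h2].
  by move=> h; split=> [|j js]; apply: h; rewrite inE ?eqxx ?js ?orbT.
apply: foset_iff (h (enum K)) _ => a.
by split=> h' k //; apply: h'; rewrite mem_enum.
Qed.

Let quantifiable (K : Type) :=
  forall I (w : I -> sorts L) (u : K -> sorts L) (A : tup M (pair_ctx w u) -> Prop),
    foset A -> foset (fun a => forall y : tup M u, A (pair_tuple a y)).

Lemma eval_cast J (w' : J -> sorts L) K (u : K -> sorts L) (a : tup M w') k k'
    (e : k = k') (t : term w' (u k)) :
  eval a (eq_rect k (fun k => term w' (u k)) t k' e) =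
  eq_rect k (fun k => M (u k)) (eval a t) k' e.
Proof. by case: _ / e. Qed.

Lemma cast_tup K (u : K -> sorts L) (y : tup M u) k k' (e : k = k') :
  eq_rect k (fun k => M (u k)) (y k) k' e = y k'.
Proof. by case: _ / e. Qed.

(** A retract is enough: the coordinates of [K'] are given the sorts [u (g k')], and the sort at
    [g (f k)] is transported to the one at [k] by [eq_rect]. *)
Let quantifiable_can K K' (f : K -> K') g :
  cancel f g -> quantifiable K' -> quantifiable K.
Proof.
move=> fK hK' I w u A hA.
pose u' k' := u (g k').
pose e (k : I + K) : term (pair_ctx w u') (pair_ctx w u k) :=
  match k with
  | inl i => Var (pair_ctx w u') (inl i)
  | inr k => eq_rect (g (f k)) (fun k => term (pair_ctx w u') (u k))
               (Var (pair_ctx w u') (inr (f k))) k (fK k)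
  end.
apply: foset_iff (hK' _ _ _ _ (foset_sub e hA)) _ => a; split=> h y.
  have := h (fun k => y (g k)); congr (A _).
  apply: functional_extensionality_dep => -[i|k] //=.
  by rewrite eval_cast /= cast_tup.
have := h (fun k => eq_rect (g (f k)) (fun k => M (u k)) (y (f k)) k (fK k)).
congr (A _); apply: functional_extensionality_dep => -[i|k] //=; by rewrite eval_cast.
Qed.

Let quantifiable_void : quantifiable void.
Proof.
move=> I w u A hA.
pose e (k : I + void) : term w (pair_ctx w u k) :=
  match k with inl i => Var w i | inr x => match x with end end.
apply: foset_iff (foset_sub e hA) _ => a.
have E y : (fun i => eval a (e i)) = pair_tuple a y.
  by apply: functional_extensionality_dep => -[].
split=> [h y|h]; first by rewrite -E.
by rewrite (E (fun x => match x with end)).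
Qed.

Let quantifiable_option K : quantifiable K -> quantifiable (option K).
Proof.
move=> hK I w u A hA.
pose s := u None; pose u' k := u (Some k); pose w' := ext w s.
pose e (k : I + option K) : term (pair_ctx w' u') (pair_ctx w u k) :=
  match k with
  | inl i => Var (pair_ctx w' u') (inl (Some i))
  | inr None => Var (pair_ctx w' u') (inl None)
  | inr (Some k) => Var (pair_ctx w' u') (inr k)
  end.
apply: foset_iff (foset_all (hK _ _ _ _ (foset_sub e hA))) _ => a; split=> h y.
  have := h (y None) (fun k => y (Some k)); congr (A _).
  by apply: functional_extensionality_dep => -[i|[k|]].
move=> z; have := h (fun o => match o return M (u o) with
                          | Some k => z k | None => y end).
by congr (A _); apply: functional_extensionality_dep => -[i|[k|]].
Qed.

(** The syntax binds one variable at a time, so a block of quantifiers is peeled off by induction on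
    its size, [unlift ord0] identifying ['I_n.+1] with [option 'I_n]. *)
Lemma foset_forall_tup (K : finType) I (w : I -> sorts L) (u : K -> sorts L)
    (A : tup M (pair_ctx w u) -> Prop) :
  foset A -> foset (fun a => forall y : tup M u, A (pair_tuple a y)).
Proof.
suff h n : quantifiable 'I_n.
  by move: I w u A; apply: quantifiable_can (h #|K|); exact: enum_rankK.
elim: n => [|n IH].
  have f : 'I_0 -> void by case.
  by apply: (quantifiable_can (f := f) (g := of_void _)) quantifiable_void => -[].
apply: (quantifiable_can (f := unlift ord0) (g := oapp (lift ord0) ord0));
  last exact: quantifiable_option.
by move=> i; case: unliftP.
Qed.

Lemma foset_exists_tup (K : finType) I (w : I -> sorts L) (u : K -> sorts L)
    (A : tup M (pair_ctx w u) -> Prop) :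
  foset A -> foset (fun a => exists y : tup M u, A (pair_tuple a y)).
Proof.
move=> /foset_not/foset_forall_tup/foset_not h.
apply: foset_iff h _ => a; split=> [/existsNP[y /contrapT hy]|[y hy] h].
  by exists y.
exact: h hy.
Qed.

End Substitution.

(** * A countable syntax with named variables *)

Section Syntax.
Variable S : signature.

(** The dependently typed formulas have contexts over arbitrary types and cannot be enumerated as
    they stand. Numbering the variables gives a countable type of formulas, as the diagonal and
    Henkin constructions below demand, and lets a single type of valuations [nat -> N tt] serve all
    of them. *)
Inductive tm :=
| TVar (x : nat)
| TApp (f : sg_fun S) (t : 'I_(sg_far f) -> tm).

Inductive fm :=
| FBot
| FEq (t u : tm)
| FRel (r : sg_rel S) (t : 'I_(sg_rar r) -> tm)
| FImp (p q : fm)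
| FAll (x : nat) (p : fm).

Fixpoint tm_tree (t : tm) : GenTree.tree nat :=
  match t with
  | TVar x => GenTree.Leaf x
  | TApp f t => GenTree.Node (pickle f) [seq tm_tree (t i) | i <- enum 'I_(sg_far f)]
  end.

Fixpoint tree_tm (T : GenTree.tree nat) : tm :=
  match T with
  | GenTree.Leaf x => TVar x
  | GenTree.Node n Ts =>
      if unpickle n is Some f
      then TApp (f := f) (fun i => nth (TVar 0) (map tree_tm Ts) i) else TVar 0
  end.

Lemma tm_treeK : cancel tm_tree tree_tm.
Proof.
elim=> //= f t IH; rewrite pickleK; congr TApp; apply/funext => i.
by rewrite -map_comp (nth_map i) ?size_enum_ord // nth_ord_enum /= IH.
Qed.

Fixpoint fm_tree (p : fm) : GenTree.tree nat :=
  match p with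
  | FBot => GenTree.Node 0 [::]
  | FEq t u => GenTree.Node 1 [:: tm_tree t; tm_tree u]
  | FRel r t => GenTree.Node 2 (GenTree.Leaf (pickle r) ::
                  [seq tm_tree (t i) | i <- enum 'I_(sg_rar r)])
  | FImp p q => GenTree.Node 3 [:: fm_tree p; fm_tree q]
  | FAll x p => GenTree.Node 4 [:: GenTree.Leaf x; fm_tree p]
  end.

Fixpoint tree_fm (T : GenTree.tree nat) : fm :=
  match T with
  | GenTree.Node 1 [:: t; u] => FEq (tree_tm t) (tree_tm u)
  | GenTree.Node 2 (GenTree.Leaf n :: Ts) =>
      if unpickle n is Some r
      then FRel (r := r) (fun i => nth (TVar 0) (map tree_tm Ts) i) else FBot
  | GenTree.Node 3 [:: p; q] => FImp (tree_fm p) (tree_fm q)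
  | GenTree.Node 4 [:: GenTree.Leaf x; p] => FAll x (tree_fm p)
  | _ => FBot
  end.

Lemma fm_treeK : cancel fm_tree tree_fm.
Proof.
elim=> //= [t u|r t|p -> q ->//|x p ->//]; first by rewrite !tm_treeK.
rewrite pickleK; congr FRel; apply/funext => i.
by rewrite -map_comp (nth_map i) ?size_enum_ord // nth_ord_enum /= tm_treeK.
Qed.

HB.instance Definition _ := Countable.copy fm (can_type fm_treeK).

Definition FNot p := FImp p FBot.
Definition FAnd p q := FNot (FImp p (FNot q)).

Definition upd U (v : nat -> U) x u := fun y => if y == x then u else v y.

Lemma upd_id U (v : nat -> U) x : upd v x (v x) = v.
Proof. by apply/funext => y; rewrite /upd; case: eqP => [->|]. Qed.

Section Sat.
Variable N : structure S.
Implicit Type v : nat -> N tt.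

Fixpoint teval v (t : tm) : N tt :=
  match t with
  | TVar x => v x
  | TApp f t => fint N f (fun i => teval v (t i))
  end.

Fixpoint fsat v (p : fm) : Prop :=
  match p with
  | FBot => False
  | FEq t u => teval v t = teval v u
  | FRel r t => rint N r (fun i => teval v (t i))
  | FImp p q => fsat v p -> fsat v q
  | FAll x p => forall u, fsat (upd v x u) p
  end.

Definition fvalid p := forall v, fsat v p.

Lemma fsat_and v p q : fsat v (FAnd p q) <-> fsat v p /\ fsat v q.
Proof.
split=> [h|[hp hq] h]; last exact: h.
by split; apply: contrapT => h'; apply: h => //= ?.
Qed.

Definition agree n v v' := forall x, x < n -> v x = v' x.

(** A semantic substitute, relative to [N], for having all free variables below [n]; no set of free
    variables is ever computed. *)
Definition depends n p := forall v v', agree n v v' -> fsat v p -> fsat v' p.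

Lemma agree_sym n v v' : agree n v v' -> agree n v' v.
Proof. by move=> h x /h ->. Qed.

Lemma depends_imp n p q : depends n p -> depends n q -> depends n (FImp p q).
Proof.
move=> hp hq v v' e /= h sp; apply: hq (e) _; apply: h.
exact: hp (agree_sym e) sp.
Qed.

Lemma depends_not n p : depends n p -> depends n (FNot p).
Proof. by move=> h; apply: depends_imp. Qed.

Lemma depends_and n p q : depends n p -> depends n q -> depends n (FAnd p q).
Proof. by move=> hp hq; apply/depends_not/depends_imp/depends_not. Qed.

Lemma depends_leq m n p : m <= n -> depends m p -> depends n p.
Proof. by move=> le h v v' e; apply: h => x lt; apply/e/(leq_trans lt). Qed.

End Sat.

Fixpoint tbound (t : tm) : nat :=
  match t with
  | TVar x => x.+1
  | TApp f t => \max_(i < sg_far f) tbound (t i)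
  end.

(** Only an upper bound is wanted, so bound variables are not discounted. *)
Fixpoint fbound (p : fm) : nat :=
  match p with
  | FBot => 0
  | FEq t u => maxn (tbound t) (tbound u)
  | FRel r t => \max_(i < sg_rar r) tbound (t i)
  | FImp p q => maxn (fbound p) (fbound q)
  | FAll _ p => fbound p
  end.

Lemma teval_agree (N : structure S) t (v v' : nat -> N tt) :
  agree (tbound t) v v' -> teval v t = teval v' t.
Proof.
elim: t => [x|f t IH] /= h; first exact: h.
congr (fint N f); apply: functional_extensionality_dep => i; apply: IH => x lt.
by apply: h; apply: leq_trans lt _; exact: leq_bigmax.
Qed.

Lemma depends_fbound (N : structure S) p : depends N (fbound p) p.
Proof.
elim: p => [|t u|r t|p IHp q IHq|x p IH] //=.
- move=> v v' e /=; rewrite (teval_agree (v := v) (v' := v')) => [->|y lt].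
    by apply: teval_agree => y lt; apply: e; rewrite leq_max lt orbT.
  by apply: e; rewrite leq_max lt.
- move=> v v' e /=; congr (rint N r _); apply: functional_extensionality_dep => i.
  apply: teval_agree => y lt; apply: e; apply: leq_trans lt _.
  exact: leq_bigmax.
- by apply: depends_imp; [apply: depends_leq IHp|apply: depends_leq IHq];
    rewrite leq_max leqnn ?orbT.
- move=> v v' e /= h u; apply: IH (h u) => y lt; rewrite /upd.
  by case: ifP => // _; apply: e.
Qed.

Fixpoint tren (e : nat -> nat) (t : tm) : tm :=
  match t with
  | TVar x => TVar (e x)
  | TApp f t => TApp (fun i => tren e (t i))
  end.

(* [m] is meant to bound the range of [e]: bound variables are renamed to fresh
   ones from [m] on. *)
Fixpoint fren (e : nat -> nat) (m : nat) (p : fm) : fm :=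
  match p with
  | FBot => FBot
  | FEq t u => FEq (tren e t) (tren e u)
  | FRel r t => FRel (fun i => tren e (t i))
  | FImp p q => FImp (fren e m p) (fren e m q)
  | FAll x p => FAll m (fren (upd e x m) m.+1 p)
  end.

Lemma teval_tren (N : structure S) e (v : nat -> N tt) t :
  teval v (tren e t) = teval (v \o e) t.
Proof.
elim: t => //= f t IH; congr (fint N f).
by apply: functional_extensionality_dep.
Qed.

Lemma fsat_fren (N : structure S) p e m (v : nat -> N tt) :
  (forall x, e x < m) -> fsat v (fren e m p) <-> fsat (v \o e) p.
Proof.
elim: p e m v => [|t u|r t|p IHp q IHq|x p IH] e m v le //=.
- by rewrite !teval_tren.
- rewrite (_ : (fun i => _) = (fun i => teval (v \o e) (t i))) //.
  by apply/funext => i; rewrite teval_tren.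
- by rewrite IHp // IHq.
- have E u : upd v m u \o upd e x m = upd (v \o e) x u.
    apply/funext => y; rewrite /upd /=; case: (y == x); first by rewrite eqxx.
    by rewrite ltn_eqF.
  split=> h u; have := h u; rewrite IH ?E // => y; rewrite /upd;
    by case: eqP => // _; apply: leq_trans (le y) _.
Qed.

(** The sort of a variable is an element of [unit] but need not reduce to [tt]; this coercion and
    the next two are identities once the sort is destructed. *)
Definition from_tt (N : structure S) (s : unit) : N tt -> N s :=
  match s with tt => id end.

Definition to_tt (N : structure S) (s : unit) : N s -> N tt :=
  match s with tt => id end.

Definition term_tt I (w : I -> sorts S) (s : unit) : term w s -> term w tt :=
  match s with tt => id end.

Fixpoint tm_of I (w : I -> sorts S) (e : I -> nat) s (t : term w s) : tm :=
  match t with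
  | Var i => TVar (e i)
  | App f t => TApp (f := f) (fun i => tm_of e (t i))
  end.

(** The names given by [e] are meant to lie below the numeric argument, which is therefore the next
    fresh name. *)
Fixpoint fm_of I (w : I -> sorts S) (p : formula w) : (I -> nat) -> nat -> fm :=
  match p with
  | Bot => fun _ _ => FBot
  | Equal _ t u => fun e _ => FEq (tm_of e t) (tm_of e u)
  | Rel r t => fun e _ => FRel (r := r) (fun i => tm_of e (t i))
  | Imp p q => fun e n => FImp (fm_of p e n) (fm_of q e n)
  | All s p => fun e n => FAll n (fm_of p (oapp e n) n.+1)
  end.

Lemma teval_tm_of (N : structure S) I (w : I -> sorts S) (e : I -> nat) s
    (t : term w s) (v : nat -> N tt) :
  eval (fun i => from_tt (w i) (v (e i))) t = from_tt s (teval v (tm_of e t)).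
Proof.
elim: t => //= f t IH; congr (fint N f).
by apply: functional_extensionality_dep => i; rewrite IH.
Qed.

Lemma fsat_fm_of (N : structure S) I (w : I -> sorts S) (p : formula w) e n
    (v : nat -> N tt) : (forall i, e i < n) ->
  fsat v (fm_of p e n) <-> sat p (fun i => from_tt (w i) (v (e i))).
Proof.
elim: p e n v => {I w} [I w|I w s t u|I w r t|I w p IHp q IHq|I w s p IH] e n v le //=.
- by rewrite !teval_tm_of; case: s t u.
- rewrite (_ : (fun i => eval _ _) = (fun i => teval v (tm_of e (t i)))) //.
  by apply: functional_extensionality_dep => i; rewrite teval_tm_of.
- by rewrite IHp // IHq.
- have E u : (fun o => from_tt (ext w s o) (upd v n u (oapp e n o))) =
             ext_tuple (fun i => from_tt (w i) (v (e i))) (from_tt s u).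
    apply: functional_extensionality_dep => -[i|] /=; rewrite /upd ?eqxx //.
    by rewrite ltn_eqF.
  have le' o : oapp e n o < n.+1 by case: o => //= i; apply: ltnW; apply: le.
  split=> [h x|h u]; last by apply/IH => //; rewrite E.
  have := h (to_tt x); rewrite IH // E.
  by rewrite (_ : from_tt s (to_tt x) = x) //; case: s x {p IH h E}.
Qed.

Fixpoint term_of I (w : I -> sorts S) (e : nat -> I) (t : tm) : term w tt :=
  match t with
  | TVar x => term_tt (Var w (e x))
  | TApp f t => App (L := S) (f := f) (fun i => term_of w e (t i))
  end.

Fixpoint formula_of (p : fm) I (w : I -> sorts S) (e : nat -> I) : formula w :=
  match p with
  | FBot => Bot w
  | FEq t u => Equal (term_of w e t) (term_of w e u)
  | FRel r t => Rel (L := S) (r := r) (fun i => term_of w e (t i))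
  | FImp p q => Imp (formula_of p w e) (formula_of q w e)
  | FAll x p => All (s := tt : sorts S)
      (formula_of p (ext w (tt : sorts S))
         (fun y => if y == x then None else Some (e y)))
  end.

Lemma eval_term_of (N : structure S) I (w : I -> sorts S) (e : nat -> I) t
    (a : tup N w) :
  eval a (term_of w e t) = teval (fun x => to_tt (a (e x))) t.
Proof.
elim: t => [x|f t IH] /=.
  rewrite /term_tt /to_tt.
  by move: (Var w (e x)) (erefl : eval a (Var w (e x)) = a (e x)); case: (w (e x)) (a (e x)).
congr (fint N f); by apply: functional_extensionality_dep.
Qed.

Lemma sat_formula_of (N : structure S) p I (w : I -> sorts S) (e : nat -> I)
    (a : tup N w) :
  sat (formula_of p w e) a <-> fsat (fun x => to_tt (a (e x))) p.
Proof.
elim: p I w e a => [|t u|r t|p IHp q IHq|x p IH] I w e a //=.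
- by rewrite !eval_term_of.
- rewrite (_ : (fun i => eval _ _) =
               (fun i => teval (fun x => to_tt (a (e x))) (t i))) //.
  by apply: functional_extensionality_dep => i; rewrite eval_term_of.
- by rewrite IHp IHq.
- split=> h u; have := h u; rewrite IH; congr (fsat _ p); apply/funext => y;
    by rewrite /upd; case: eqP.
Qed.

Lemma fsat_closure (N : structure S) p s (v0 v : nat -> N tt) :
  fsat v0 (foldr FAll p s) -> (forall x, x \notin s -> v x = v0 x) -> fsat v p.
Proof.
elim: s v0 => [|x s IH] v0 /= h e.
  by rewrite (_ : v = v0) //; apply/funext => x; apply: e.
apply: (IH (upd v0 x (v x))) (h _) _ => y ys; rewrite /upd.
by case: eqP => [->//|/eqP ne]; apply: e; rewrite inE negb_or ne.
Qed.

Lemma fvalid_model (N N' : structure S) :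
  model_of_theory N N' -> forall p, fvalid N p -> fvalid N' p.
Proof.
move=> h p hp v.
pose n := fbound p; pose q := foldr FAll p (iota 0 n).
have hq (N0 : structure S) : fvalid N0 p -> fvalid N0 q.
  by move=> hp0; rewrite /q; elim: (iota 0 n) => //= x s IH v' u; apply: IH.
(* [formula_of] must send every name to a variable, and the context of a sentence has none. A dummy
   outer quantifier supplies one; the closure [q] binds the first [n] names, so only irrelevant
   names are sent there, and all of them take the value [v 0] below. *)
pose e (x : nat) : option void := None.
have := h (All (s := tt : sorts S) (formula_of q (ext (of_void _) (tt : sorts S)) e)).
rewrite /holds /= => /(_ _)/wrap[z|/(_ (v 0))]; rewrite sat_formula_of.
  exact: hq.
move=> /fsat_closure hz.
apply: (@depends_fbound _ p (fun x => if x < n then v x else v 0)).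
  by move=> x lt; rewrite lt.
by apply: hz => x; rewrite mem_iota /= add0n => /negbTE ->.
Qed.

Lemma model_fvalid (N N' : structure S) :
  (forall p, fvalid N p -> fvalid N' p) -> model_of_theory N N'.
Proof.
move=> h p hp; rewrite /holds.
pose e (i : void) : nat := match i with end.
have E (N0 : structure S) (v : nat -> N0 tt) :
    fsat v (fm_of p e 0) <-> holds N0 p.
  rewrite fsat_fm_of; last by case.
  by rewrite (_ : (fun i => _) = (fun i : void => match i with end)) //;
    apply: functional_extensionality_dep => -[].
have [u] := carrier_inhabited N' tt.
by apply/(E _ (fun=> u)); apply: h => v; apply/E.
Qed.

End Syntax.

(** * Ultrapowers *)

Lemma sval_inj T (P : T -> Prop) : injective (@sval T P).
Proof. by move=> [x px] [y py] /= e; apply: eq_exist. Qed.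

Section Ultrapower.
Variables (S : signature) (N : structure S) (F : set_system nat).
Hypothesis FU : UltraFilter F.

Let FP : ProperFilter F := ultra_proper.

Definition ueq s (a b : nat -> N s) := F [set k | a k = b k].

Definition upow_carrier (s : sorts S) :=
  {c : set (nat -> N s) | exists a, c = ueq a}.

Definition ucls s (a : nat -> N s) : upow_carrier s :=
  exist _ (ueq a) (ex_intro _ a erefl).

Definition urep s (c : upow_carrier s) : nat -> N s := sval (cid (svalP c)).

Lemma ueq_refl s (a : nat -> N s) : ueq a a.
Proof. exact: filterE. Qed.

Lemma ueq_sym s (a b : nat -> N s) : ueq a b -> ueq b a.
Proof. by apply: filterS => k /= ->. Qed.

Lemma ueq_trans s (a b c : nat -> N s) : ueq a b -> ueq b c -> ueq a c.
Proof. by apply: filterS2 => k /= -> ->. Qed.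

Lemma uclsP s (a b : nat -> N s) : ucls a = ucls b <-> ueq a b.
Proof.
split=> [/(congr1 sval) /= ->|h]; first exact: ueq_refl.
apply: eq_exist; apply/funext => c; apply/propext; split.
  exact/ueq_trans/ueq_sym.
exact: ueq_trans.
Qed.

Lemma urepK s (c : upow_carrier s) : ucls (urep c) = c.
Proof. by apply: sval_inj; rewrite /urep; case: cid. Qed.

Lemma upow_inhabited s : inhabited (upow_carrier s).
Proof. by have [x] := carrier_inhabited N s; apply/inhabits/(ucls (fun=> x)). Qed.

Definition upow : structure S := {|
  carrier := upow_carrier;
  carrier_inhabited := upow_inhabited;
  fint := fun f a => ucls (fun k => fint N f (fun i => urep (a i) k));
  rint := fun r a => F [set k | rint N r (fun i => urep (a i) k)]
|}.

(** The operations of the ultrapower are computed on chosen representatives. Arities being finite,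
    these agree with any given representatives on a common set of [F], which takes the place of a
    well-definedness proof. *)
Lemma urep_ucls (K : finType) (w : K -> sorts S) (a : forall i, nat -> N (w i)) :
  F [set k | (fun i => urep (ucls (a i)) k) = (fun i => a i k)].
Proof.
have h i : F [set k | urep (ucls (a i)) k = a i k] by apply/uclsP; rewrite urepK.
apply: filterS (filter_forall _ h) => k /= e.
by apply: functional_extensionality_dep.
Qed.

Lemma teval_upow (a : nat -> nat -> N tt) t :
  teval (N := upow) (fun x => ucls (a x)) t = ucls (fun k => teval (fun x => a x k) t).
Proof.
elim: t => // f t IH.
transitivity (fint upow f (fun i => ucls (fun k => teval (fun x => a x k) (t i)))).
  rewrite [LHS]/=; congr (fint upow f).
  by apply: functional_extensionality_dep => i; rewrite IH.
apply/uclsP; apply: filterS (urep_ucls (w := fdom S f)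
                               (fun i k => teval (fun x => a x k) (t i))).
by move=> k /= ->.
Qed.

(* Los's theorem. *)
Lemma fsat_upow (a : nat -> nat -> N tt) p :
  fsat (N := upow) (fun x => ucls (a x)) p <-> F [set k | fsat (fun x => a x k) p].
Proof.
elim: p a => [|t u|r t|p IHp q IHq|x p IH] a.
- by split=> // /filter_ex[].
- by rewrite /= !teval_upow uclsP.
- have E : (fun i => teval (N := upow) (fun x => ucls (a x)) (t i)) =
             (fun i => ucls (fun k => teval (fun x => a x k) (t i))).
    by apply: functional_extensionality_dep => i; rewrite teval_upow.
  change (rint upow r (fun i => teval (N := upow) (fun x => ucls (a x)) (t i)) <->
          F [set k | rint N r (fun i => teval (fun x => a x k) (t i))]).
  rewrite E.
  have h := urep_ucls (w := rdom S r) (fun i k => teval (fun x => a x k) (t i)).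
  by split; apply: filterS2 h => k /= ->.
- rewrite /= IHp IHq; split=> [h|]; last exact: filterS2.
  have [/h|] := in_ultra_setVsetC [set k | fsat (fun x => a x k) p] FU.
    by apply: filterS => k /=.
  by apply: filterS => k /= nh /nh.
- have E b : (fun y => ucls (upd a x b y)) = upd (fun y => ucls (a y)) x (ucls b).
    by apply/funext => y; rewrite /upd; case: ifP.
  have E' b k : (fun y => upd a x b y k) = upd (fun y => a y k) x (b k).
    by apply/funext => y; rewrite /upd; case: ifP.
  split=> /= h; last first.
    move=> u; rewrite -(urepK u) -E IH; apply: filterS h => k /= h.
    by rewrite E'.
  have [//|nF] := in_ultra_setVsetC [set k | fsat (fun x => a x k) (FAll x p)] FU.
  have hb k : exists u, ~ fsat (fun x => a x k) (FAll x p) ->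
                        ~ fsat (upd (fun y => a y k) x u) p.
    have [|/existsNP[u nu]] := pselect (fsat (fun x => a x k) (FAll x p)).
      by exists (a 0 k).
    by exists u.
  have [b {}hb] := choice hb.
  have := h (ucls b); rewrite -E IH => hF.
  have [k []] := filter_ex (filterI nF hF).
  by rewrite /= E' => /hb.
Qed.

End Ultrapower.

(** * Countable elementary substructures *)

(** The common pattern of the two Henkin constructions below. Each task has to recur at arbitrarily
    late stages, since it may refer to elements that are not yet built when it first comes up. *)
Lemma exists_scheduled_sequence U (T : countType) (t0 : T)
    (P : seq U -> Prop) (good : seq U -> T -> U -> Prop) :
  P [::] -> (forall s t, P s -> exists u, P (rcons s u) /\ good s t u) ->
  exists b : nat -> U, (forall k, P (mkseq b k)) /\
    forall t n, exists k, n <= k /\ good (mkseq b k) t (b k).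
Proof.
move=> P0 step.
have [u0 _] := step [::] t0 P0.
have h st : exists u, P st.1 -> P (rcons st.1 u) /\ good st.1 st.2 u.
  have [/(step _ st.2)[u hu]|nP] := pselect (P st.1); first by exists u.
  by exists u0.
have [f hf] := choice h.
(* The exponent of 2 in [k.+1] takes every value infinitely often; [2 ^ pickle t * n.*2.+1] is the
   value of [k.+1] that schedules [t] at stage [n] or later. *)
pose task k := odflt t0 (unpickle (logn 2 k.+1)).
pose s := fix s k := if k is k'.+1 then rcons (s k') (f (s k', task k')) else [::].
pose b k := f (s k, task k).
have sE k : mkseq b k = s k.
  by elim: k => // k IH; rewrite mkseqS IH.
have Ps k : P (s k) by elim: k => //= k /(hf (_, task k))[].
exists b; split=> [k|t n]; first by rewrite sE.
pose m := 2 ^ pickle t * n.*2.+1.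
have m0 : 0 < m by rewrite muln_gt0 expn_gt0.
exists m.-1; split.
  rewrite -ltnS prednK //; apply: (@leq_trans n.*2.+1).
    by rewrite ltnS -addnn leq_addr.
  by rewrite leq_pmull ?expn_gt0.
have {1}-> : t = task m.-1.
  rewrite /task prednK // /m lognM ?expn_gt0 // pfactorK //.
  by rewrite (@lognE 2 n.*2.+1) /= dvdn2 /= odd_double addn0 pickleK.
by rewrite sE; have [] := hf (s m.-1, task m.-1) (Ps _).
Qed.

Section Substructure.
Variables (S : signature) (N : structure S).

Definition tarski_vaught (X : set (N tt)) :=
  forall p x (v : nat -> N tt), (forall y, X (v y)) ->
    (exists u, fsat (upd v x u) p) -> exists u, X u /\ fsat (upd v x u) p.

Lemma tarski_vaught_substructure (b : nat -> N tt) :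
  tarski_vaught (range b) ->
  exists (N' : structure S) (h : N' tt -> N tt),
    [/\ countable_structure N', forall k, exists x, h x = b k,
        forall x, exists k, h x = b k
      & forall p v, fsat v p <-> fsat (h \o v) p].
Proof.
move=> TV; pose X := range b.
have closed f (a : forall i, {u | X u}) : X (fint N f (fun i => sval (a i))).
  pose n := sg_far f.
  pose v y := if insub y is Some i then sval (a i) else b 0.
  (* Closure under [f] is the Tarski-Vaught test for [x_n = f(x_0, ..., x_(n-1))], whose only
     witness is the value of [f]. *)
  have [||u [Xu]] := TV (FEq (TVar _ n) (TApp (f := f) (fun i => TVar _ i))) n v.
  - by move=> y; rewrite /v; case: insub => [i|]; [exact: svalP|exists 0].
  - exists (fint N f (fun i => sval (a i))); rewrite /= {1}/upd eqxx.
    congr (fint N f); apply: functional_extensionality_dep => i.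
    by rewrite /upd ltn_eqF // /v valK.
  rewrite /= {1}/upd eqxx => eu; move: Xu; rewrite {}eu; congr X.
  congr (fint N f); apply: functional_extensionality_dep => i.
  by rewrite /upd ltn_eqF // /v valK.
have b0 : X (b 0) by exists 0.
pose N' : structure S := {|
  carrier := fun=> {u | X u};
  carrier_inhabited := fun=> inhabits (exist X (b 0) b0);
  fint := fun f a => exist X _ (closed f a);
  rint := fun r a => rint N r (fun i => sval (a i)) |}.
have tE (v : nat -> N' tt) t : sval (teval v t) = teval (fun x => sval (v x)) t.
  elim: t => //= f t IH; congr (fint N f).
  exact: functional_extensionality_dep.
exists N', sval; split=> [[]|k|[x [k q e]]|].
- apply/countable_injP.
  have h (u : {u | X u}) : exists k, b k = sval u by case: u => u [k q e]; exists k.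
  have [f hf] := choice h; exists f => x y _ _ e; apply: sval_inj.
  by rewrite -!hf e.
- by exists (exist X (b k) (ex_intro2 _ _ k I erefl)).
- by exists k.
- elim=> [|t u|r t|p IHp q IHq|x p IH] v //=.
  + rewrite -!tE; split=> [->//|e]; exact: sval_inj.
  + rewrite (_ : (fun i => sval _) = (fun i => teval (sval \o v) (t i))) //.
    by apply/funext => i; rewrite tE.
  + by rewrite IHp IHq.
  + have E u : sval \o upd v x u = upd (sval \o v) x (sval u).
      by apply/funext => y; rewrite /upd /=; case: ifP.
    split=> h; last by move=> u; rewrite IH E.
    move=> u; apply: contrapT => nu.
    have [||u' [Xu']] := TV (FNot p) x (sval \o v).
    * by move=> y; apply: svalP.
    * by exists u.
    * by apply; have := h (exist X u' Xu'); rewrite IH E.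
Qed.

(** A formula sees finitely many variables, so its parameters in the range of [b] are encoded by a
    finite list [r] of indices; this leaves only countably many tasks. *)
Lemma tarski_vaught_range (b : nat -> N tt) :
  (forall p x (r : seq nat), (exists u, fsat (upd (b \o nth 0 r) x u) p) ->
     exists k, fsat (upd (b \o nth 0 r) x (b k)) p) ->
  tarski_vaught (range b).
Proof.
move=> h p x v Xv [u hu].
have Xv' y : exists k, b k = v y by have [k _ <-] := Xv y; exists k.
have [f hf] := choice Xv'.
pose r := mkseq f (fbound p).
have e u' : agree (fbound p) (upd v x u') (upd (b \o nth 0 r) x u').
  by move=> y lt; rewrite /upd; case: ifP => //= _; rewrite nth_mkseq // hf.
have [|k hk] := h p x r; first by exists u; apply: depends_fbound hu; exact: e.
exists (b k); split; first by exists k.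
by apply: depends_fbound hk; apply: agree_sym; exact: e.
Qed.

Lemma lowenheim_skolem (v0 : nat -> N tt) :
  exists (N' : structure S) (h : N' tt -> N tt),
    [/\ countable_structure N', forall k, exists x, h x = v0 k
      & forall p v, fsat v p <-> fsat (h \o v) p].
Proof.
pose good s (t : nat + fm S * nat * seq nat) u :=
  match t with
  | inl i => u = v0 i
  | inr (p, x, r) => (exists u', fsat (upd (nth (v0 0) s \o nth 0 r) x u') p) ->
       fsat (upd (nth (v0 0) s \o nth 0 r) x u) p
  end.
have [||b [_ hb]] := @exists_scheduled_sequence _ _ (inl 0) (fun=> True) good => //.
  move=> s [i|[[p x] r]] _ /=; first by exists (v0 i).
  by have [[u hu]|n] := pselect (exists u', fsat (upd (nth (v0 0) s \o nth 0 r) x u') p);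
    [exists u|exists (v0 0)].
have [|N' [h [cN h1 _ h2]]] := @tarski_vaught_substructure b.
  apply: tarski_vaught_range => p x r [u hu].
  (* The stage must come after all the indices used by the valuation; [0] is among them because it
     is the default of [nth 0 r]. *)
  have [k [le]] := hb (inr (p, x, r)) (\max_(i <- 0 :: r) i).+1.
  have E : nth (v0 0) (mkseq b k) \o nth 0 r = b \o nth 0 r.
    apply/funext => y /=; rewrite nth_mkseq //; apply: leq_trans le.
    rewrite ltnS; have [lt|ge] := ltnP y (size r); last by rewrite nth_default.
    by apply: leq_bigmax_seq => //; rewrite inE mem_nth ?orbT.
  by rewrite /= E => /(_ (ex_intro _ u hu)); exists k.
exists N', h; split=> // i.
have [k [_ e]] := hb (inl i) 0; have [x hx] := h1 k.
by exists x; rewrite hx e.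
Qed.

End Substructure.

(** * The Ryll-Nardzewski theorem *)

Section IsolatedTypes.
Variables (S : signature) (N : structure S).
Hypothesis N_countable : countable_structure N.
Hypothesis N_unique : forall N' : structure S, countable_structure N' ->
  (forall p, fvalid N p -> fvalid N' p) -> isomorphic N N'.
Implicit Type v : nat -> N tt.

Lemma elementary_iso (N' : structure S) (h : forall s, N s -> N' s) :
  bijective (h tt) ->
  (forall f a, h _ (fint N f a) = fint N' f (fun i => h _ (a i))) ->
  (forall r a, rint N r a <-> rint N' r (fun i => h _ (a i))) ->
  forall p v, fsat v p <-> fsat (h tt \o v) p.
Proof.
move=> [g hK gK] hf hr.
have tE v t : h tt (teval v t) = teval (h tt \o v) t.
  elim: t => //= f t IH; rewrite (hf f); congr (fint N' f).
  exact: functional_extensionality_dep.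
elim=> [|t u|r t|p IHp q IHq|x p IH] v //=.
- by rewrite -!tE; split=> [->//|/(can_inj hK)].
- rewrite (hr r) (_ : (fun i => h _ _) = (fun i => teval (h tt \o v) (t i))) //.
  by apply/funext => i; exact: tE.
- by rewrite IHp IHq.
- have E u : h tt \o upd v x u = upd (h tt \o v) x (h tt u).
    by apply/funext => y; rewrite /upd /=; case: ifP.
  by split=> e u; [rewrite -(gK u) -E -IH|rewrite IH E].
Qed.

Lemma iso_of_elementary (N' : structure S) (i : N' tt -> N tt) :
  countable_structure N' ->
  (forall p (v : nat -> N' tt), fsat v p <-> fsat (i \o v) p) ->
  exists h : N tt -> N' tt, bijective h /\ forall p v, fsat v p <-> fsat (h \o v) p.
Proof.
move=> cN' hi; have [|h [bh hf hr]] := N_unique cN'.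
  by move=> p hp v; apply/hi/hp.
by exists (h tt); split; [exact: bh|exact: elementary_iso].
Qed.

(** The sequence of partial solutions is a solution in an ultrapower over an ultrafilter finer than
    the cofinite filter. Lowenheim-Skolem brings this solution into a countable model, and
    uniqueness of the countable model brings it into [N]. *)
Lemma realized (p : nat -> fm S) :
  (forall n, exists v, forall i, i < n -> fsat v (p i)) ->
  exists v, forall i, fsat v (p i).
Proof.
move=> /choice[a ha].
have [F [FU sF]] := ultraFilterLemma eventually_filter.
have FP : ProperFilter F := @ultra_proper _ _ FU.
pose v0 x := @ucls S N F tt (fun n => a n x).
have hv0 i : fsat (N := upow N F) v0 (p i).
  by apply/fsat_upow/sF; exists i.+1 => // n /=; exact: ha.
have [N' [j [cN' hj1 hj2]]] := lowenheim_skolem (N := upow N F) v0.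
have [|h [bh hf hr]] := N_unique cN'.
  move=> q hq v; apply/hj2.
  rewrite (_ : j \o v = (fun x => ucls F (urep (j (v x))))).
    by apply/fsat_upow; apply: filterE => k; exact: hq.
  by apply/funext => x; rewrite urepK.
have [w hw] := choice hj1; have [g hK gK] := bh tt.
exists (g \o w) => i; rewrite (elementary_iso (bh tt) hf hr) hj2.
rewrite (_ : j \o _ = v0) //; apply/funext => x /=.
by rewrite gK hw.
Qed.

(** The formula [q] isolates a complete [n]-type. An unsatisfiable [q] qualifies vacuously, whence
    the second clause of [isolated]. *)
Definition isolating n q := depends N n q /\
  forall p, depends N n p ->
    (forall v, fsat v q -> fsat v p) \/ (forall v, fsat v q -> ~ fsat v p).

Definition isolated n v := exists q, isolating n q /\ fsat v q.

Lemma enum_valuations n : exists a : nat -> nat -> N tt,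
  forall v, exists i, agree n v (a i).
Proof.
have [x0] := carrier_inhabited N tt.
have /countable_injP[f finj] := N_countable tt.
have [g hg] : exists g : nat -> N tt, forall x, g (f x) = x.
  have h k : exists x, forall y, f y = k -> x = y.
    have [[y <-]|ne] := pselect (exists y, f y = k).
      by exists y => z /finj; rewrite !in_setT => /(_ isT isT).
    by exists x0 => y e; case: ne; exists y.
  by have [g hg] := choice h; exists g => x; apply: hg.
exists (fun i x => g (nth 0 (odflt [::] (unpickle i)) x)) => v.
exists (pickle (mkseq (f \o v) n)) => x lt.
by rewrite pickleK /= nth_mkseq //= hg.
Qed.

(* A formula without isolated solutions can be strengthened step by step so as
   to exclude every tuple of [N], contradicting [realized]. *)
Lemma isolated_dense n p : depends N n p -> (exists v, fsat v p) ->
  exists v, fsat v p /\ isolated n v.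
Proof.
move=> dp sp; apply: contrapT => /forallNP noiso.
have [a ha] := enum_valuations n.
pose TP q := [/\ depends N n q, exists v, fsat v q
                 & forall v, fsat v q -> fsat v p].
pose T := {q | TP q}.
have step (iq : nat * T) : exists q' : T,
    (forall v, fsat v (sval q') -> fsat v (sval iq.2)) /\
    ~ fsat (a iq.1) (sval q').
  case: iq => i [q [dq [v0 sq] qp]] /=.
  have [saq|] := pselect (fsat (a i) q); last first.
    by move=> nq; exists (exist TP q (And3 dq (ex_intro _ v0 sq) qp)).
  have : ~ isolating n q.
    by move=> iq; apply: (noiso (a i)); split; [exact: qp|exists q].
  move=> /not_andP[//|/existsNP[r /not_implyP[dr /not_orP[
    /existsNP[v1 /not_implyP[v1q v1r]] /existsNP[v2 /not_implyP[v2q /contrapT v2r]]]]]].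
  have [sar|nsar] := pselect (fsat (a i) r).
    have h : TP (FAnd q (FNot r)).
      split; first exact: depends_and (depends_not _).
        by exists v1; apply/fsat_and.
      by move=> v /fsat_and[/qp].
    by exists (exist TP _ h); split=> [v /fsat_and[]//|/fsat_and[_]]; apply.
  have h : TP (FAnd q r).
    split; first exact: depends_and.
      by exists v2; apply/fsat_and.
    by move=> v /fsat_and[/qp].
  by exists (exist TP _ h); split=> [v /fsat_and[]//|/fsat_and[_]].
have [f hf] := choice step.
pose q0 : T := exist TP p (And3 dp sp (fun _ => id)).
pose q := fix q i := if i is i'.+1 then f (i', q i') else q0.
have mono i j v : i <= j -> fsat v (sval (q j)) -> fsat v (sval (q i)).
  move=> /subnK <-; elim: (j - i) => //= k IH h; apply: IH.
  by have [h' _] := hf (k + i, q (k + i)); apply: h'.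
have [|v hv] := realized (p := fun i => sval (q i)).
  move=> m; have [_ [v hv] _] := svalP (q m); exists v => i lt.
  by apply: mono hv; apply: ltnW.
have [i agr] := ha v; have [_] := hf (i, q i); apply.
by have [d _ _] := svalP (q i.+1); apply: d agr (hv i.+1).
Qed.

(** By density some isolated [k.+1]-tuple satisfies [q] and [p], but it need not begin with [s]. As
    [q] isolates the [k]-type of [s], the formula saying that some [x_k] satisfies [r] holds of both
    beginnings, and its witness for [s] is the extension. *)
Lemma isolated_extend k (s : nat -> N tt) p : isolated k s ->
  depends N k.+1 p -> (exists u, fsat (upd s k u) p) ->
  exists u, isolated k.+1 (upd s k u) /\ fsat (upd s k u) p.
Proof.
move=> [q [[dq iq] sq]] dp [u hu].
have agr u' : agree k s (upd s k u') by move=> x lt; rewrite /upd ltn_eqF.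
have [||v [/fsat_and[vq vp] [r [[dr ir] vr]]]] := @isolated_dense k.+1 (FAnd q p).
- by apply: depends_and => //; apply: depends_leq dq.
- by exists (upd s k u); apply/fsat_and; split=> //; apply: dq sq; exact: agr.
have rp v' : fsat v' r -> fsat v' p.
  by have [h|/(_ _ vr)//] := ir p dp; exact: h.
pose ex_r := FNot (FAll k (FNot r)).
have dex : depends N k ex_r.
  move=> v1 v2 e h1 h2; apply: h1 => u' h; apply: (h2 u'); apply: dr h => x.
  rewrite ltnS leq_eqVlt /upd => /predU1P[->|lt]; first by rewrite eqxx.
  by rewrite ltn_eqF // e.
have [h|/(_ _ vq)[]] := iq ex_r dex; last by move/(_ (v k)); rewrite upd_id; apply.
have /existsNP[u' /contrapT hu'] := h s sq.
by exists u'; split; [exists r|exact: rp].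
Qed.

Lemma foset_fm n (A : tup N (fun _ : 'I_n => tt : sorts S) -> Prop) :
  foset A -> exists p, forall v, fsat v p <-> A (fun i => v i).
Proof. by case=> p hp; exists (fm_of p (@nat_of_ord n) n) => v; rewrite fsat_fm_of. Qed.

(** If [q] isolates the type of [b], the type of a tuple of coordinates of [b] is isolated by the
    projection of [q]: there is [y] satisfying [q] with [a i = y (f i)] for all [i]. *)
Lemma isolated_proj n m f (b v : nat -> N tt) : (forall x, x < n -> f x < m) ->
  (forall x, v x = b (f x)) -> isolated m b -> isolated n v.
Proof.
(* [inord] needs a nonempty ordinal type; for [m = 0] only the empty tuple is left. *)
case: m => [|m] lt vE [q [[dq iq] sq]].
  case: n lt => [_|n /(_ 0 isT)//]; exists q; split; first by split.
  exact: dq sq.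
pose wn (_ : 'I_n) : sorts S := tt; pose wm (_ : 'I_m.+1) : sorts S := tt.
pose w := pair_ctx wn wm.
have [|p hp] := @foset_fm n (fun a => exists y : tup N wm,
    fsat (fun x => y (inord x)) q /\ forall i, a i = y (inord (f i))).
  apply: foset_iff (@foset_exists_tup _ N _ _ wn wm
    (fun a => fsat (fun x => a (inr (inord x))) q /\
              forall i, a (inl i) = a (inr (inord (f i)))) _) _ => //.
  apply: foset_and.
    exists (formula_of q w (fun x => inr (inord x))) => a.
    by rewrite sat_formula_of.
  apply: foset_forall_fin => i.
  exact: foset_eq (Var w (inl i)) (Var w (inr (inord (f i)))).
exists p; split; last first.
  apply/hp; exists (fun i => b i); split=> [|i]; last by rewrite inordK ?lt.
  by apply: dq sq => x lx; rewrite inordK.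
have dp : depends N n p.
  move=> v1 v2 agr /hp[y [h1 h2]]; apply/hp; exists y; split=> // i.
  by rewrite -h2 agr.
split=> // r dr.
pose e x := if x < n then f x else 0.
have le x : e x < m.+1 by rewrite /e; case: ifP => // /lt.
have dr' : depends N m.+1 (fren e m.+1 r).
  move=> v1 v2 agr; rewrite !fsat_fren //.
  by rewrite (_ : v1 \o e = v2 \o e) //; apply/funext => x /=; apply: agr.
have key v' : fsat v' p -> exists v1, fsat v1 q /\ agree n (v1 \o e) v'.
  move=> /hp[y [h1 h2]]; exists (fun x => y (inord x)); split=> // x lx.
  by rewrite /= /e lx (h2 (Ordinal lx)).
have [h|h] := iq _ dr'; [left|right] => v' /key[v1 [/h]];
  rewrite fsat_fren // => h1 agr; first exact: dr agr h1.
by move=> h2; apply: h1; apply: dr h2; exact: agree_sym.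
Qed.

(** A Henkin construction inside [N] that keeps every initial segment isolated enumerates an atomic
    elementary substructure. By uniqueness it is isomorphic to [N], so any tuple of [N] has the type
    of a tuple of coordinates of [b]. *)
Lemma isolated_all n v : isolated n v.
Proof.
have [x0] := carrier_inhabited N tt.
pose val s : nat -> N tt := nth x0 s.
pose good s (t : fm S * nat * seq nat) u := let: (p, x, r) := t in
  (forall y, nth 0 r y < size s) -> (exists u', fsat (upd (val s \o nth 0 r) x u') p) ->
  fsat (upd (val s \o nth 0 r) x u) p.
have val_rcons s u : agree (size s).+1 (val (rcons s u)) (upd (val s) (size s) u).
  move=> x; rewrite ltnS /val /upd nth_rcons leq_eqVlt.
  by case: eqP => [-> _|_ /= ->//]; rewrite ltnn.
have iso_agree k v1 v2 : agree k v1 v2 -> isolated k v1 -> isolated k v2.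
  by move=> e [q [[dq iq] sq]]; exists q; split=> //; apply: dq sq.
have [||b [hiso hb]] := @exists_scheduled_sequence _ _ (FBot S, 0, [::])
   (fun s => isolated (size s) (val s)) good.
- have e v1 v2 : agree 0 v1 v2 by [].
  exists (FNot (FBot S)); split=> //; split=> [|p dp]; first exact/depends_not.
  have [h|h] := pselect (fsat (val [::]) p).
    by left=> v' _; apply: dp h.
  by right=> v' _ h'; apply: h; apply: dp h'.
- move=> s [[p x] r] iso.
  have [[lt [u hu]]|ng] := pselect ((forall y, nth 0 r y < size s) /\
        exists u', fsat (upd (val s \o nth 0 r) x u') p).
    pose k := size s; pose e y := if y == x then k else nth 0 r y.
    have le y : e y < k.+1 by rewrite /e; case: eqP => // _; rewrite ltnS ltnW.
    pose p' := fren e k.+1 p.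
    have E u' : upd (val s) k u' \o e = upd (val s \o nth 0 r) x u'.
      apply/funext => y; rewrite /= /upd /e; case: (y == x); first by rewrite eqxx.
      by rewrite ltn_eqF.
    have [||u' [iso' sp']] := isolated_extend (p := p') iso.
    + move=> v1 v2 agr; rewrite !fsat_fren //.
      by rewrite (_ : v1 \o e = v2 \o e) //; apply/funext => y /=; apply: agr.
    + by exists u; rewrite fsat_fren // E.
    exists u'; split.
      by rewrite size_rcons; apply: iso_agree iso'; apply/agree_sym/val_rcons.
    by move=> _ _; rewrite -E -(fsat_fren p (upd _ _ _) le).
  (* The task asks for nothing at this stage; extending for a true formula still keeps the segment
     isolated. *)
  have [||u [iso' _]] := isolated_extend (p := FNot (FBot S)) iso.
  + exact/depends_not.
  + by exists x0.
  exists u; split.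
      by rewrite size_rcons; apply: iso_agree iso'; apply/agree_sym/val_rcons.
  by move=> h1 h2; case: ng.
have TV : tarski_vaught (range b).
  apply: tarski_vaught_range => p x r [u hu].
  have [k [le]] := hb (p, x, r) (\max_(i <- 0 :: r) i).+1.
  have lt y : nth 0 r y < k.
    apply: leq_trans le.
    rewrite ltnS; have [lt|ge] := ltnP y (size r); last by rewrite nth_default.
    by apply: leq_bigmax_seq => //; rewrite inE mem_nth ?orbT.
  have E : val (mkseq b k) \o nth 0 r = b \o nth 0 r.
    by apply/funext => y /=; rewrite /val nth_mkseq.
  rewrite /= E size_mkseq => h; exists k; apply: h => //; by exists u.
have [N' [i [cN' _ hi1 hi2]]] := tarski_vaught_substructure TV.
have [h [bh hh]] := iso_of_elementary cN' hi2.
have tr p v' : fsat v' p <-> fsat (i \o h \o v') p by rewrite hh hi2.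
suff [q [[dq iq] sq]] : isolated n (i \o h \o v).
  exists q; split; last by apply/tr.
  by split.
have [f hf] : exists f, forall x, i (h (v x)) = b (f x).
  by have [f hf] := choice hi1; exists (fun x => f (h (v x))) => x; apply: hf.
pose m := (\max_(x < n) f x).+1.
have lt x : x < n -> f x < m.
  by move=> lt; rewrite ltnS; apply: (leq_bigmax (Ordinal lt)).
have := hiso m; rewrite size_mkseq => /iso_agree isob.
apply: (isolated_proj (b := b) lt hf).
by apply: isob => x lx; rewrite /val nth_mkseq.
Qed.

(** An isolating formula that meets the union of the [p k] is contained in one of them. If no finite
    subfamily covered, a solution of some [p k] outside enough of the [p j] would thus avoid any
    finitely many isolating formulas; a point avoiding them all would then exist in [N], against
    [isolated_all]. *)
Lemma fm_cover n (p : nat -> fm S) : (forall k, depends N n (p k)) ->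
  exists K, forall k v, fsat v (p k) -> exists2 j, j < K & fsat v (p j).
Proof.
move=> dp; apply: contrapT => /forallNP noK.
pose q i := if unpickle i is Some q
  then if `[< isolating n q >] then FNot q else FNot (FBot S) else FNot (FBot S).
have [|v hv] := realized (p := q).
  move=> m.
  have hJ i : exists J, forall r, unpickle i = Some r -> isolating n r ->
      (exists v k, fsat v r /\ fsat v (p k)) -> exists2 v : nat -> N tt, fsat v r &
        exists2 j, j < J & fsat v (p j).
    case: (unpickle i) => [r|]; last by exists 0.
    have [[v [k [h1 h2]]]|no] := pselect (exists v k, fsat v r /\ fsat v (p k)).
      by exists k.+1 => _ [<-] _ _; exists v => //; exists k.
    by exists 0 => _ [<-] _ /no.
  have [J {}hJ] := choice hJ.
  have /existsNP[k /existsNP[v /not_implyP[pk no]]] := noK (\max_(i < m) J i).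
  exists v => i lt; rewrite /q; case ei: (unpickle i) => [r|]; last by move=> /=.
  case: asboolP => [isor /= vr|_]; last by move=> /=.
  have [|v' v'r [j ltj v'j]] := hJ i r ei isor; first by exists v, k.
  apply: no; exists j.
    by apply: leq_trans ltj _; exact: (leq_bigmax (Ordinal lt)).
  by have [_ /(_ _ (dp j))[|/(_ _ v'r)//]] := isor; apply.
have [r [isor vr]] := isolated_all n v.
by have := hv (pickle r); rewrite /q pickleK; case: asboolP => [_|//]; apply.
Qed.

End IsolatedTypes.

(* The form in which omega-categoricity is used: a family of definable sets in
   finitely many variables (parameters included) has a finite subcover. *)
Theorem formula_cover (S : signature) (M : structure S) (I : finType)
    (w : I -> sorts S) (p : nat -> formula w) :
  omega_categorical M ->
  exists K, forall k (a : tup M w), sat (p k) a -> exists2 j, j < K & sat (p j) a.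
Proof.
move=> [N [cN NM uN]].
(* The theory of a structure is complete, so the inclusion of theories is an equality: a universal
   closure false in [M] has its negation true in [N]. *)
have MN q : fvalid M q <-> fvalid N q.
  split=> [|hq]; first exact: fvalid_model.
  apply: contrapT => /existsNP[v nv].
  pose n := fbound q; pose cl := foldr (@FAll S) q (iota 0 n).
  have clE (N0 : structure S) (v0 : nat -> N0 tt) : fvalid N0 q <-> fsat v0 cl.
    split=> [h|h v1].
      by rewrite /cl; elim: (iota 0 n) v0 => //= x s IH v0 u; apply: IH.
    apply: (@depends_fbound _ _ q (fun x => if x < n then v1 x else v0 x)).
      by move=> x lt; rewrite lt.
    apply: fsat_closure h _ => x.
    by rewrite mem_iota /= add0n => /negbTE ->.
  have [u] := carrier_inhabited N tt.
  have hcl : fvalid M (FNot cl) by move=> v0 /clE /(_ v).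
  by apply: (fvalid_model NM hcl (fun=> u)); apply/clE.
have uN' (N' : structure S) : countable_structure N' ->
    (forall q, fvalid N q -> fvalid N' q) -> isomorphic N N'.
  move=> cN' h; apply: uN => //; apply: model_fvalid => q hq.
  exact/h/MN.
pose e (i : I) : nat := enum_rank i; pose n := #|I|.
have le i : e i < n by exact: ltn_ord.
pose q k := fm_of (p k) e n.
have [|K hK] := fm_cover cN uN' (n := n) (p := q).
  move=> k v v' agr; rewrite !fsat_fm_of //.
  by rewrite (_ : (fun i => _) = (fun i => from_tt (w i) (v' (e i)))) //;
    apply: functional_extensionality_dep => i; rewrite agr.
have [u] := carrier_inhabited M tt.
exists K => k a ha.
pose v x := if insub x is Some j then to_tt (a (enum_val (A := I) j)) else u.
have aE : a = (fun i => from_tt (w i) (v (e i))).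
  apply: functional_extensionality_dep => i; rewrite /v /e valK enum_rankK.
  by rewrite /from_tt /to_tt; case: (w i) (a i).
pose ex m := foldr (fun j r => FImp (FNot (q j)) r) (FBot S) (iota 0 m).
have exE (N0 : structure S) (v0 : nat -> N0 tt) m :
    fsat v0 (ex m) <-> exists2 j, j < m & fsat v0 (q j).
  have h s : fsat v0 (foldr (fun j r => FImp (FNot (q j)) r) (FBot S) s) <->
             exists2 j, j \in s & fsat v0 (q j).
    elim: s => [|j s IH] /=; first by split=> // -[].
    rewrite IH; split=> [h|[j']].
      have [hj|nj] := pselect (fsat v0 (q j)); first by exists j; rewrite ?inE ?eqxx.
      by have [j' j's hj'] := h nj; exists j'; rewrite // inE j's orbT.
    by rewrite inE => /predU1P[->//|j's hj' _]; exists j'.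
  rewrite h; split=> -[j jm hj]; exists j => //; first by rewrite mem_iota in jm.
  by rewrite mem_iota.
(* For each [k], being covered by the first [K] sets is a single formula, so the bound found in [N]
   holds in [M]. *)
have : fvalid M (FImp (q k) (ex K)).
  by apply/MN => v0 /= /hK ?; apply/exE.
move=> /(_ v) /=; rewrite exE fsat_fm_of // -aE => /(_ ha)[j jK].
by rewrite fsat_fm_of // -aE; exists j.
Qed.

(** * Definability over a fixed tuple of parameters *)

Section PairTuples.
Variables (L : language) (M : structure L).

Lemma pair_tuple_inj I J (v : I -> sorts L) (w : J -> sorts L)
    (a a' : tup M v) (b b' : tup M w) :
  pair_tuple a b = pair_tuple a' b' -> a = a' /\ b = b'.
Proof.
by move=> e; split; apply: functional_extensionality_dep => i;
  [exact: (f_equal (fun t => t (inl i)) e)|exact: (f_equal (fun t => t (inr i)) e)].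
Qed.

Lemma pair_tuple_eta I J (v : I -> sorts L) (w : J -> sorts L)
    (a : tup M (pair_ctx v w)) :
  a = pair_tuple (fun i => a (inl i)) (fun j => a (inr j)).
Proof. by apply: functional_extensionality_dep => -[]. Qed.

End PairTuples.

Section OverParams.
Variables (L : language) (M : structure L).
Variables (J : finType) (v : J -> sorts L) (b : tup M v).

Definition pdef I (w : I -> sorts L) (A : tup M w -> Prop) :=
  exists p : formula (pair_ctx w v), forall a, sat p (pair_tuple a b) <-> A a.

(** A type presented as a set definable over [b]. Since the predicates on one [dtype] share
    variables and parameters, countable families of them fall under [formula_cover]. *)
Record dtype := Dtype {
  dt_sort :> Type;
  dt_idx : finType;
  dt_ctx : dt_idx -> sorts L;
  dt_emb : dt_sort -> tup M dt_ctx;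
  dt_inj : injective dt_emb;
  dt_range : pdef (fun a => exists x, a = dt_emb x)
}.
Arguments dt_emb : clear implicits.

Definition dpred (X : dtype) (P : X -> Prop) :=
  exists p : formula (pair_ctx (@dt_ctx X) v),
    forall x, sat p (pair_tuple (dt_emb X x) b) <-> P x.

Definition dprod_emb (X Y : dtype) (z : X * Y) := pair_tuple (dt_emb X z.1) (dt_emb Y z.2).

Lemma dprod_inj X Y : injective (@dprod_emb X Y).
Proof. by move=> [x y] [x' y'] /pair_tuple_inj[/dt_inj /= -> /dt_inj /= ->]. Qed.

Lemma dprod_range (X Y : dtype) : pdef (fun a => exists z, a = @dprod_emb X Y z).
Proof.
have [p hp] := dt_range X; have [q hq] := dt_range Y.
pose w := pair_ctx (pair_ctx (@dt_ctx X) (@dt_ctx Y)) v.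
pose e1 k : term w (pair_ctx (@dt_ctx X) v k) :=
  match k with inl i => Var w (inl (inl i)) | inr j => Var w (inr j) end.
pose e2 k : term w (pair_ctx (@dt_ctx Y) v k) :=
  match k with inl i => Var w (inl (inr i)) | inr j => Var w (inr j) end.
have [r hr] := foset_and (foset_sub e1 (foset_sat M p)) (foset_sub e2 (foset_sat M q)).
exists r => a; rewrite hr.
have -> : (fun i => eval (pair_tuple a b) (e1 i)) = pair_tuple (fun i => a (inl i)) b.
  by apply: functional_extensionality_dep => -[].
have -> : (fun i => eval (pair_tuple a b) (e2 i)) = pair_tuple (fun i => a (inr i)) b.
  by apply: functional_extensionality_dep => -[].
rewrite hp hq; split=> [[[x ex] [y ey]]|[[x y] ->]]; last by split; [exists x|exists y].
by exists (x, y); rewrite [a]pair_tuple_eta ex ey.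
Qed.

Canonical dprod (X Y : dtype) := Dtype (@dprod_inj X Y) (dprod_range X Y).

Lemma dpred_iff (X : dtype) (P Q : X -> Prop) :
  dpred P -> (forall x, P x <-> Q x) -> dpred Q.
Proof. by case=> p hp h; exists p => x; rewrite hp h. Qed.

Lemma dpred_of_foset (X : dtype) (A : tup M (pair_ctx (@dt_ctx X) v) -> Prop) :
  foset A -> dpred (fun x => A (pair_tuple (dt_emb X x) b)).
Proof. by case=> p hp; exists p => x; rewrite hp. Qed.

Lemma dpred_false (X : dtype) : dpred (fun _ : X => False).
Proof. exact: dpred_of_foset (foset_false _ _). Qed.

Lemma dpred_imp (X : dtype) (P Q : X -> Prop) :
  dpred P -> dpred Q -> dpred (fun x => P x -> Q x).
Proof. by case=> p hp [q hq]; exists (Imp p q) => x /=; rewrite hp hq. Qed.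

Lemma dpred_not (X : dtype) (P : X -> Prop) : dpred P -> dpred (fun x => ~ P x).
Proof. by move=> h; apply: dpred_imp h (dpred_false X). Qed.

Lemma dpred_true (X : dtype) : dpred (fun _ : X => True).
Proof. by apply: dpred_iff (dpred_not (dpred_false X)) _ => x; split=> // _ []. Qed.

Lemma dpred_and (X : dtype) (P Q : X -> Prop) :
  dpred P -> dpred Q -> dpred (fun x => P x /\ Q x).
Proof.
move=> hP hQ; apply: dpred_iff (dpred_not (dpred_imp hP (dpred_not hQ))) _ => x.
split=> [h|[h1 h2] h]; last exact: h.
by split; apply: contrapT => h'; apply: h => // ?.
Qed.

Lemma dpred_or (X : dtype) (P Q : X -> Prop) :
  dpred P -> dpred Q -> dpred (fun x => P x \/ Q x).
Proof.
move=> hP hQ; apply: dpred_iff (dpred_imp (dpred_not hP) hQ) _ => x.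
split=> [h|[|]//].
by have [|n] := pselect (P x); [left|right; apply: h].
Qed.

Lemma dpred_all (X Y : dtype) (P : X -> Y -> Prop) :
  dpred (fun z : dprod X Y => P z.1 z.2) -> dpred (fun x => forall y, P x y).
Proof.
case=> p hp; have [q hq] := dt_range Y.
pose w := pair_ctx (pair_ctx (@dt_ctx X) v) (@dt_ctx Y).
pose e1 k : term w (pair_ctx (@dt_ctx Y) v k) :=
  match k with inl i => Var w (inr i) | inr j => Var w (inl (inr j)) end.
pose e2 k : term w (pair_ctx (pair_ctx (@dt_ctx X) (@dt_ctx Y)) v k) :=
  match k with
  | inl (inl i) => Var w (inl (inl i))
  | inl (inr i) => Var w (inr i)
  | inr j => Var w (inl (inr j))
  end.
have [r hr] := foset_forall_tup
  (foset_imp (foset_sub e1 (foset_sat M q)) (foset_sub e2 (foset_sat M p))).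
exists r => x; rewrite hr.
have E1 y : (fun i => eval (pair_tuple (pair_tuple (dt_emb X x) b) y) (e1 i)) =
            pair_tuple y b.
  by apply: functional_extensionality_dep => -[].
have E2 y : (fun i => eval (pair_tuple (pair_tuple (dt_emb X x) b) y) (e2 i)) =
            pair_tuple (pair_tuple (dt_emb X x) y) b.
  by apply: functional_extensionality_dep => -[[]|].
split=> h y.
  have := h (dt_emb Y y); rewrite E1 E2 hq => /(_ (ex_intro _ y erefl)).
  by move/(hp (x, y)).
rewrite E1 E2 hq => -[y' ->]; exact/(hp (x, y'))/h.
Qed.

Lemma dpred_ex (X Y : dtype) (P : X -> Y -> Prop) :
  dpred (fun z : dprod X Y => P z.1 z.2) -> dpred (fun x => exists y, P x y).
Proof.
move=> /dpred_not hP.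
have h := dpred_not (dpred_all (P := fun x y => ~ P x y) hP).
apply: dpred_iff h _ => x; split=> [/existsNP[y /contrapT]|[y hy] h].
  by exists y.
exact: h hy.
Qed.

(** Maps whose coordinates are terms, so that predicates pull back along them by substitution.
    Projections and pairings are of this kind; they rearrange variables in the proofs that maps with
    definable graph, [dfun], compose. *)
Definition sfun (X Y : dtype) (f : X -> Y) :=
  exists e : forall i, term (@dt_ctx X) (@dt_ctx Y i),
    forall x i, eval (dt_emb X x) (e i) = dt_emb Y (f x) i.

Lemma sfun_id (X : dtype) : sfun (fun x : X => x).
Proof. by exists (fun i => Var _ i). Qed.

Lemma sfun_fst (X Y Z : dtype) (f : X -> dprod Y Z) :
  sfun f -> sfun (fun x => (f x).1).
Proof. by case=> e he; exists (fun i => e (inl i)) => x i; apply: (he x (inl i)). Qed.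

Lemma sfun_snd (X Y Z : dtype) (f : X -> dprod Y Z) :
  sfun f -> sfun (fun x => (f x).2).
Proof. by case=> e he; exists (fun i => e (inr i)) => x i; apply: (he x (inr i)). Qed.

Lemma sfun_pair (X Y Z : dtype) (f : X -> Y) (g : X -> Z) :
  sfun f -> sfun g -> sfun (Y := dprod Y Z) (fun x => (f x, g x)).
Proof.
case=> e he [e' he'].
exists (fun k => match k return term _ (pair_ctx (@dt_ctx Y) (@dt_ctx Z) k) with
           inl i => e i | inr j => e' j end) => x.
by case=> i /=; rewrite ?he ?he'.
Qed.

Lemma dpred_sfun (X Y : dtype) (f : X -> Y) (P : Y -> Prop) :
  sfun f -> dpred P -> dpred (fun x => P (f x)).
Proof.
case=> e he [p hp].
pose w := pair_ctx (@dt_ctx X) v.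
pose e' k : term w (pair_ctx (@dt_ctx Y) v k) :=
  match k with
  | inl i => tsub (fun i => Var w (inl i)) (e i)
  | inr j => Var w (inr j)
  end.
have [q hq] := foset_sub e' (foset_sat M p).
exists q => x; rewrite hq -hp.
rewrite (_ : (fun i => _) = pair_tuple (dt_emb Y (f x)) b) //.
apply: functional_extensionality_dep => -[i|//] /=.
by rewrite eval_tsub -he.
Qed.

Lemma dpred_id (X : dtype) : dpred (fun z : dprod X X => z.1 = z.2).
Proof.
pose w := pair_ctx (pair_ctx (@dt_ctx X) (@dt_ctx X)) v.
have [p hp] : foset (fun a : tup M w => forall i, a (inl (inl i)) = a (inl (inr i))).
  apply: foset_forall_fin => i.
  exact: foset_eq (Var w (inl (inl i))) (Var w (inl (inr i))).
exists p => -[x y]; rewrite hp; split=> [h|/= -> //].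
exact/dt_inj/functional_extensionality_dep.
Qed.

Definition dfun (X Y : dtype) (f : X -> Y) :=
  dpred (fun z : dprod X Y => f z.1 = z.2).

Lemma dfun_sfun (X Y : dtype) (f : X -> Y) : sfun f -> dfun f.
Proof.
move=> hf.
apply: (dpred_sfun (Y := dprod Y Y) (P := fun z => z.1 = z.2)
          (f := fun z : dprod X Y => (f z.1, z.2))); last exact: dpred_id.
apply: sfun_pair; last exact/sfun_snd/sfun_id.
case: hf => e he; exists (fun i => tsub (fun i => Var (pair_ctx _ _) (inl i)) (e i)) => z i.
by rewrite eval_tsub -he.
Qed.

Lemma dpred_comp (X Y : dtype) (f : X -> Y) (P : Y -> Prop) :
  dfun f -> dpred P -> dpred (fun x => P (f x)).
Proof.
move=> hf hP; apply: (dpred_iff (P := fun x => exists y, f x = y /\ P y)).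
  apply: dpred_ex; apply: dpred_and; first exact: hf.
  exact: dpred_sfun (sfun_snd (sfun_id _)) hP.
by move=> x; split=> [[y [<-]]|h] //; exists (f x).
Qed.

Lemma dfun_comp (X Y Z : dtype) (f : X -> Y) (g : Y -> Z) :
  dfun f -> dfun g -> dfun (fun x => g (f x)).
Proof.
move=> hf hg; apply: (dpred_iff (P := fun z : dprod X Z => exists y, f z.1 = y /\ g y = z.2)).
  apply: dpred_ex; apply: dpred_and.
    apply: (dpred_sfun (Y := dprod X Y) (P := fun z => f z.1 = z.2)
              (f := fun z : dprod (dprod X Z) Y => (z.1.1, z.2))) hf.
    by apply: sfun_pair; [apply/sfun_fst/sfun_fst/sfun_id|apply/sfun_snd/sfun_id].
  apply: (dpred_sfun (Y := dprod Y Z) (P := fun z => g z.1 = z.2)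
            (f := fun z : dprod (dprod X Z) Y => (z.2, z.1.2))) hg.
  by apply: sfun_pair; [apply/sfun_snd/sfun_id|apply/sfun_snd/sfun_fst/sfun_id].
by move=> z; split=> [[y [<-]]|h] //; exists (f z.1).
Qed.

Lemma dfun_pair (X Y Z : dtype) (f : X -> Y) (g : X -> Z) :
  dfun f -> dfun g -> dfun (Y := dprod Y Z) (fun x => (f x, g x)).
Proof.
move=> hf hg.
apply: (dpred_iff (P := fun z : dprod X (dprod Y Z) => f z.1 = z.2.1 /\ g z.1 = z.2.2)).
  apply: dpred_and.
    apply: (dpred_sfun (Y := dprod X Y) (P := fun z => f z.1 = z.2)
              (f := fun z : dprod X (dprod Y Z) => (z.1, z.2.1))) hf.
    by apply: sfun_pair; [apply/sfun_fst/sfun_id|apply/sfun_fst/sfun_snd/sfun_id].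
  apply: (dpred_sfun (Y := dprod X Z) (P := fun z => g z.1 = z.2)
            (f := fun z : dprod X (dprod Y Z) => (z.1, z.2.2))) hg.
  by apply: sfun_pair; [apply/sfun_fst/sfun_id|apply/sfun_snd/sfun_snd/sfun_id].
by case=> x [y z] /=; split=> [[-> ->]|[-> ->]].
Qed.

Lemma dfun_id (X : dtype) : dfun (fun x : X => x).
Proof. exact/dfun_sfun/sfun_id. Qed.

Lemma dfun_fst (X Y Z : dtype) (f : X -> dprod Y Z) :
  dfun f -> dfun (fun x => (f x).1).
Proof. by move=> hf; apply: dfun_comp hf _; apply/dfun_sfun/sfun_fst/sfun_id. Qed.

Lemma dfun_snd (X Y Z : dtype) (f : X -> dprod Y Z) :
  dfun f -> dfun (fun x => (f x).2).
Proof. by move=> hf; apply: dfun_comp hf _; apply/dfun_sfun/sfun_snd/sfun_id. Qed.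

Lemma dpred_eq (X Y : dtype) (f g : X -> Y) :
  dfun f -> dfun g -> dpred (fun x => f x = g x).
Proof.
move=> hf hg; exact: (dpred_comp (P := fun z : dprod Y Y => z.1 = z.2)
                        (dfun_pair hf hg) (dpred_id Y)).
Qed.

Lemma dfun_comp2 (X Y Z T : dtype) (f : X -> Y) (g : X -> Z) (h : Y -> Z -> T) :
  dfun f -> dfun g -> dfun (fun z : dprod Y Z => h z.1 z.2) ->
  dfun (fun x => h (f x) (g x)).
Proof. by move=> hf hg; apply: (dfun_comp (dfun_pair hf hg)). Qed.

Lemma dpred_image (X : dtype) (P : X -> Prop) :
  dpred P <-> pdef (fun a => exists2 x, P x & dt_emb X x = a).
Proof.
split=> [[p hp]|[p hp]].
  have [q hq] := dt_range X.
  have [r hr] := foset_and (foset_sat M p) (foset_sat M q).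
  exists r => a; rewrite hr hq; split=> [[h [x e]]|[x hx <-]].
    by exists x => //; apply/hp; rewrite -e.
  by split; [apply/hp|exists x].
by exists p => x; rewrite hp; split=> [[y hy /dt_inj <-]|hx] //; exists x.
Qed.

End OverParams.

Lemma dpred_cover (S : signature) (M : structure S) (J : finType) (v : J -> sorts S)
    (b : tup M v) (X : dtype b) (P : nat -> X -> Prop) :
  omega_categorical M -> (forall k, dpred (P k)) ->
  exists K, forall k x, P k x -> exists2 j, j < K & P j x.
Proof.
move=> oM /choice[p hp].
have [K hK] := formula_cover p oM.
exists K => k x /hp/hK[j jK]; rewrite hp; by exists j.
Qed.

(** * Change of parameters *)

Section ParamChange.
Variables (L : language) (M : structure L).

Lemma definableP (I : finType) (w : I -> sorts L) (A : set (tup M w)) :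
  definable A <-> exists m (v : 'I_m -> sorts L) (b : tup M v), pdef b A.
Proof.
split=> [[m [v [b [p ->]]]]|[m [v [b [p hp]]]]]; exists m, v, b, p => //.
by apply/funext => a; apply/propext; rewrite -hp.
Qed.

Lemma pdef_rename (J : finType) (v : J -> sorts L) (b : tup M v) (J' : finType) (v' : J' -> sorts L)
    (b' : tup M v') (e : forall j, term v' (v j)) :
  (forall j, eval b' (e j) = b j) ->
  forall I (w : I -> sorts L) (A : tup M w -> Prop), pdef b A -> pdef b' A.
Proof.
move=> he I w A [p hp]; pose w' := pair_ctx w v'.
pose e' k : term w' (pair_ctx w v k) :=
  match k with
  | inl i => Var w' (inl i)
  | inr j => tsub (fun j => Var w' (inr j)) (e j)
  end.
have [q hq] := foset_sub e' (foset_sat M p).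
exists q => a; rewrite hq -hp.
rewrite (_ : (fun i => _) = pair_tuple a b) //.
apply: functional_extensionality_dep => -[//|j] /=.
by rewrite eval_tsub -he.
Qed.

Lemma pdef_definable (J : finType) (v : J -> sorts L) (b : tup M v)
    (I : finType) (w : I -> sorts L) (A : set (tup M w)) : pdef b A -> definable A.
Proof.
move=> hA; apply/definableP.
exists #|J|, (fun i => v (enum_val i)), (fun i => b (enum_val i)).
pose v' (i : 'I_#|J|) := v (enum_val i).
pose e j : term v' (v j) := eq_rect (enum_val (enum_rank j)) (fun j => term v' (v j))
  (Var v' (enum_rank j)) j (enum_rankK j).
by apply: (pdef_rename (e := e)) hA => j; rewrite eval_cast /= cast_tup.
Qed.

Lemma pdef_weakenl (J : finType) (v : J -> sorts L) (b : tup M v)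
    (J' : finType) (v' : J' -> sorts L) (b' : tup M v') I (w : I -> sorts L) (A : tup M w -> Prop) :
  pdef b A -> pdef (pair_tuple b b') A.
Proof. by apply: (pdef_rename (e := fun j => Var (pair_ctx v v') (inl j))). Qed.

Lemma pdef_weakenr (J : finType) (v : J -> sorts L) (b : tup M v)
    (J' : finType) (v' : J' -> sorts L) (b' : tup M v') I (w : I -> sorts L) (A : tup M w -> Prop) :
  pdef b' A -> pdef (pair_tuple b b') A.
Proof. by apply: (pdef_rename (e := fun j => Var (pair_ctx v v') (inr j))). Qed.

End ParamChange.

(** * Definable groups *)

Local Open Scope group_scope.

Section DefinableGroup.
Variables (L : language) (M : structure L) (G : definable_group M).

Definition group_base (J : finType) (v : J -> sorts L) (b : tup M v) :=
  pdef b (fun a => exists x, a = @dg_emb _ _ G x) /\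
  pdef b (graph2 (@dg_emb _ _ G) (fun x y => x * y)).

Definition set_pdef (J : finType) (v : J -> sorts L) (b : tup M v) (K : set G) :=
  pdef b (@dg_emb _ _ G @` K).

Lemma exists_group_base :
  exists (J : finType) (v : J -> sorts L) (b : tup M v), group_base b.
Proof.
have /definableP[m1 [v1 [b1 h1]]] := @dg_range _ _ G.
have /definableP[m2 [v2 [b2 h2]]] := @dg_mul _ _ G.
exists ('I_m1 + 'I_m2)%type, (pair_ctx v1 v2), (pair_tuple b1 b2).
split; last exact: pdef_weakenr.
case: (pdef_weakenl b2 h1) => p hp; exists p => a; rewrite hp.
by split=> [[x _ <-]|[x ->]]; exists x.
Qed.

Section Base.
Variables (J : finType) (v : J -> sorts L) (b : tup M v).
Hypothesis base : group_base b.

Definition gdtype : dtype b := Dtype (@dg_inj _ _ G) (proj1 base).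
Local Notation GG := gdtype.

Lemma set_pdefP (K : set G) : set_pdef b K <-> dpred (X := GG) K.
Proof. by rewrite dpred_image. Qed.

Lemma dfun_mulg : dfun (fun z : dprod GG GG => z.1 * z.2 : GG).
Proof.
case: base => _ [p hp]; exists p => -[[x y] z]; rewrite hp; split.
  by move=> [x' [y' /pair_tuple_inj[/pair_tuple_inj[/dg_inj <- /dg_inj <-] /dg_inj /= ->]]].
by move=> /= <-; exists x, y.
Qed.

Lemma dfun_mul (X : dtype b) (f g : X -> GG) :
  dfun f -> dfun g -> dfun (Y := GG) (fun x => f x * g x).
Proof. by move=> hf hg; apply: (dfun_comp2 hf hg dfun_mulg). Qed.

Lemma dpred_eqg (X : dtype b) (f g : X -> GG) :
  dfun f -> dfun g -> dpred (fun x => f x = g x).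
Proof. exact: dpred_eq. Qed.

Lemma dpred_mem (X : dtype b) (f : X -> GG) (K : set G) :
  dfun f -> dpred (X := GG) K -> dpred (fun x => K (f x)).
Proof. exact: dpred_comp. Qed.

Lemma dpred_one : dpred (X := GG) (fun x => x = 1).
Proof.
apply: (dpred_iff (P := fun x : GG => x * x = x)).
  by apply: dpred_eqg; [apply: dfun_mul; exact: dfun_id|exact: dfun_id].
by move=> x; split=> [|->]; rewrite ?mulg1 // -{3}[x]mulg1 => /mulgI.
Qed.

Lemma dfun_inv (X : dtype b) (f : X -> GG) :
  dfun f -> dfun (Y := GG) (fun x => (f x)^-1).
Proof.
move=> hf; apply: (dfun_comp (Y := GG) (Z := GG) (g := fun x => x^-1) hf).
apply: (dpred_iff (P := fun z : dprod GG GG => z.1 * z.2 = 1)).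
  exact: (dpred_comp (P := fun x : GG => x = 1) dfun_mulg dpred_one).
by case=> x y /=; split=> [/mulg1_eq|<-]; rewrite ?mulgV.
Qed.

Lemma dfun_conjg (X : dtype b) (f g : X -> GG) :
  dfun f -> dfun g -> dfun (Y := GG) (fun x => f x ^ g x).
Proof. by move=> hf hg; apply: dfun_mul (dfun_inv hg) (dfun_mul hf hg). Qed.

Lemma dfun_commg (X : dtype b) (f g : X -> GG) :
  dfun f -> dfun g -> dfun (Y := GG) (fun x => [~ f x, g x]).
Proof. by move=> hf hg; apply: dfun_mul (dfun_inv hf) (dfun_conjg hf hg). Qed.

End Base.
End DefinableGroup.

Ltac dterm := repeat first
  [ exact: dfun_id | apply: dfun_pair | apply: dfun_commg | apply: dfun_conjg
  | apply: dfun_inv | apply: dfun_mul | apply: dfun_fst | apply: dfun_snd ].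

Lemma subgroup_smallest (T : groupType) (X : set T) : subgroup (smallest (@subgroup T) X).
Proof.
split=> [|x y hx hy K hK|x hx K hK]; first by move=> K [[]].
  by have [[_ hM _] _] := hK; apply: hM; [apply: hx|apply: hy].
by have [[_ _ hV] _] := hK; apply: hV; apply: hx.
Qed.

(** * Definability of generated subgroups *)

Section Generation.
Variables (S : signature) (M : structure S).
Hypothesis oM : omega_categorical M.

Section Unions.
Variables (J : finType) (v : J -> sorts S) (b : tup M v) (X : dtype b).

Lemma dpred_exists_ltn (P : nat -> X -> Prop) K : (forall k, dpred (P k)) ->
  dpred (fun x => exists2 j, j < K & P j x).
Proof.
move=> hP; elim: K => [|K IH].
  by apply: dpred_iff (dpred_false X) _ => x; split=> // -[].
apply: dpred_iff (dpred_or IH (hP K)) _ => x; split.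
  by case=> [[j lt h]|h]; [exists j => //; apply: ltnW|exists K].
case=> j; rewrite ltnS leq_eqVlt => /predU1P[->|lt] h; first by right.
by left; exists j.
Qed.

Lemma dpred_exists_nat (P : nat -> X -> Prop) : (forall k, dpred (P k)) ->
  dpred (fun x => exists k, P k x).
Proof.
move=> hP; have [K hK] := dpred_cover oM hP.
apply: dpred_iff (dpred_exists_ltn K hP) _ => x.
by split=> [[j _ h]|[k /hK //]]; exists j.
Qed.

End Unions.

Variables (G : definable_group M) (J : finType) (v : J -> sorts S) (b : tup M v).
Hypothesis base : group_base G b.
Local Notation GG := (gdtype base).

Fixpoint words (X : set G) k : set G :=
  if k is k'.+1 then
    [set x | exists y z, [/\ words X k' y, X z & x = y * z \/ x = y * z^-1]]
  else [set 1].

Lemma smallest_subgroup_words (X : set G) :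
  smallest (@subgroup G) X = [set x | exists k, words X k x].
Proof.
have hM : forall j k x y, words X j x -> words X k y -> words X (k + j) (x * y).
  move=> j; elim=> [|k IH] x y hx /=; first by move->; rewrite mulg1.
  move=> [y' [z [hy' hz]]]; case=> ->; rewrite mulgA; exists (x * y'), z;
    (split=> //; first exact: IH); [by left|by right].
have hX z : X z -> words X 1 z by move=> hz; exists 1, z; split=> //; left; rewrite mul1g.
have hXV z : X z -> words X 1 z^-1.
  by move=> hz; exists 1, z; split=> //; right; rewrite mul1g.
have hV : forall k x, words X k x -> exists j, words X j x^-1.
  elim=> [|k IH] x /=; first by move->; exists 0; rewrite invg1.
  move=> [y [z [/IH[j hj] hz]]]; case=> ->; rewrite invgM ?invgK; exists (j + 1);
    (apply: hM => //); [exact: hXV|exact: hX].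
apply/seteqP; split; last first.
  move=> x [k]; elim: k x => [|k IH] x /=.
    by move=> ->; case: (subgroup_smallest X).
  have [_ sM sV] := subgroup_smallest X.
  move=> [y [z [/IH hy hz]]]; have hz' := @sub_gen_smallest _ (@subgroup G) X z hz.
  by case=> ->; apply: sM => //; apply: sV.
apply: smallest_sub; last by move=> x /hX; exists 1%N.
split; first by exists 0.
  by move=> x y [j hj] [k hk]; exists (k + j); apply: hM.
by move=> x [k /hV].
Qed.

Lemma dpred_smallest (X : set G) : dpred (X := GG) X ->
  dpred (X := GG) (smallest (@subgroup G) X).
Proof.
move=> hX; rewrite smallest_subgroup_words; apply: dpred_exists_nat.
elim=> [|k IH] /=; first exact: dpred_one.
apply: (dpred_iff (P := fun x : GG => exists y z : GG,
  (words X k y /\ X z) /\ (x = y * z \/ x = y * z^-1))).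
  apply: dpred_ex; apply: dpred_ex; apply: dpred_and.
    apply: dpred_and; first by apply: (dpred_mem (K := words X k)) => //; dterm.
    by apply: (dpred_mem (K := X)) => //; dterm.
  by apply: dpred_or; apply: dpred_eqg; dterm.
move=> x; split=> [[y [z [[h1 h2] h3]]]|[y [z [h1 h2 h3]]]]; exists y, z; by split.
Qed.

Lemma dpred_commutator (A B : set G) : dpred (X := GG) A -> dpred (X := GG) B ->
  dpred (X := GG) (commutator_subgroup A B).
Proof.
move=> hA hB; apply: dpred_smallest.
apply: (dpred_iff (P := fun x : GG => exists y z : GG, (A y /\ B z) /\ [~ y, z] = x)).
  apply: dpred_ex; apply: dpred_ex; apply: dpred_and.
    apply: dpred_and; first by apply: (dpred_mem (K := A)) => //; dterm.
    by apply: (dpred_mem (K := B)) => //; dterm.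
  by apply: dpred_eqg; dterm.
move=> x; split=> [[y [z [[h1 h2] <-]]]|[y hy [z hz <-]]].
  by exists y => //; exists z.
by exists y, z.
Qed.

End Generation.

(** * Subgroups of finite index and connected components *)

(** Finite relative index as a finite colouring of [H] that separates left cosets of [K]. It asks
    neither for [K] inside [H] nor for a count of cosets, and is easily pulled back along maps. *)
Definition fin_idx (T : groupType) (K H : set T) :=
  exists n (f : T -> 'I_n), forall x y, H x -> H y -> f x = f y -> K (x^-1 * y).

Lemma finite_set_fin T U (f : T -> U) : finite_set (range f) ->
  exists n (g : T -> 'I_n), forall x y, g x = g y -> f x = f y.
Proof.
pose h x : {classic U} := f x.
move=> /(finite_seqP (T := {classic U}))[s es].
exists (size s).+1, (fun x => inord (index (h x) s)) => x y /(congr1 val) /=.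
have hs z : h z \in s.
  by have : [set` s] (h z) by rewrite -es; exists z.
rewrite !inordK ?ltnS ?index_size // => e.
by rewrite -[f x]/(h x) -[f y]/(h y) -(nth_index (h x) (hs x)) e nth_index.
Qed.

Lemma finite_index_fin_idx (T : groupType) (K : set T) : subgroup K ->
  finite_index K <-> fin_idx K setT.
Proof.
move=> [K1 KM KV]; split=> [/finite_set_fin[n [f hf]]|[n [f hf]]].
  exists n, f => x y _ _ /hf e.
  have : [set x * h | h in K] y by rewrite e; exists 1 => //; rewrite mulg1.
  by case=> h Kh <-; rewrite mulKg.
have hr i : exists r, forall x, f x = i -> f r = i.
  have [[r hr]|no] := pselect (exists r, f r = i); first by exists r.
  by exists 1 => x e; case: no; exists x.
have [r {}hr] := choice hr.
apply: (@sub_finite_set _ _ ((fun i => [set r i * h | h in K]) @` setT)); last first.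
  exact: finite_image.
move=> _ [x _ <-]; exists (f x) => //.
have e : f (r (f x)) = f x by apply: (hr _ x).
apply/seteqP; split=> [_ [h Kh <-]|_ [h Kh <-]].
  exists (x^-1 * r (f x) * h); last by rewrite -mulgA mulVKg.
  by apply: KM => //; apply: hf.
exists ((r (f x))^-1 * x * h); last by rewrite -mulgA mulVKg.
by apply: KM => //; apply: hf.
Qed.

Section SubgroupAsGroup.
Variables (T : groupType) (H : set T) (sH : subgroup H).

Local Notation U := {x : T | `[< H x >]}.

Let memU (x : U) : H (val x).
Proof. by apply/asboolP; case: x. Qed.

Let mulU (x y : U) : U.
Proof.
exists (val x * val y); apply/asboolP; have [_ hM _] := sH.
by apply: hM; exact: memU.
Defined.

Let invU (x : U) : U.
Proof.
by exists (val x)^-1; apply/asboolP; have [_ _ hV] := sH; apply/hV/memU.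
Defined.

Let oneU : U.
Proof. by exists 1; apply/asboolP; case: sH. Defined.

Let mulUA : associative mulU.
Proof. by move=> x y z; apply: val_inj; rewrite /= mulgA. Qed.

Let mul1U : left_id oneU mulU.
Proof. by move=> x; apply: val_inj; rewrite /= mul1g. Qed.

Let mulU1 : right_id oneU mulU.
Proof. by move=> x; apply: val_inj; rewrite /= mulg1. Qed.

Let mulVU : left_inverse oneU invU mulU.
Proof. by move=> x; apply: val_inj; rewrite /= mulVg. Qed.

Let mulUV : right_inverse oneU invU mulU.
Proof. by move=> x; apply: val_inj; rewrite /= mulgV. Qed.

Definition subgroup_group : groupType :=
  HB.pack U (isGroup.Build U mulUA mul1U mulU1 mulVU mulUV).

Definition subgroup_val (x : subgroup_group) : T := sval x.

Lemma subgroup_val_inj : injective subgroup_val.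
Proof. by move=> x y; apply: val_inj. Qed.

Lemma subgroup_valP x : H (subgroup_val x).
Proof. exact: (memU x). Qed.

Lemma subgroup_val_surj x : H x -> exists y, subgroup_val y = x.
Proof. by move=> /asboolP h; exists (exist _ x h). Qed.

End SubgroupAsGroup.

Section Connected.
Variables (S : signature) (M : structure S) (G : definable_group M).
Implicit Types (A B H K N : set G).

Definition connected H := forall K, subgroup K -> definable_subset K ->
  K `<=` H -> fin_idx K H -> H `<=` K.

Definition component_of N H :=
  [/\ subgroup N, N `<=` H, definable_subset N, fin_idx N H
    & forall K, subgroup K -> definable_subset K -> K `<=` H -> fin_idx K H -> N `<=` K].

Section Base.
Variables (J : finType) (v : J -> sorts S) (b : tup M v).
Hypothesis base : group_base G b.
Local Notation GG := (gdtype base).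

Lemma dpred_definable K : dpred (X := GG) K -> definable_subset K.
Proof. by move=> /set_pdefP; apply: pdef_definable. Qed.

(** The coordinates of [q] join the parameters. The base is lost, but [connected] and [component_of]
    allow arbitrary parameters. *)
Lemma definable_section (P : G -> G -> Prop) q :
  dpred (fun z : dprod GG GG => P z.1 z.2) -> definable_subset [set x | P x q].
Proof.
case=> p hp; have [r hr] := dt_range GG.
pose w := @dg_ctx _ _ G; pose w' := pair_ctx w (pair_ctx v w).
pose e1 k : term w' (pair_ctx w v k) :=
  match k with inl i => Var w' (inl i) | inr j => Var w' (inr (inl j)) end.
pose e2 k : term w' (pair_ctx (pair_ctx w w) v k) :=
  match k with
  | inl (inl i) => Var w' (inl i)
  | inl (inr i) => Var w' (inr (inr i))
  | inr j => Var w' (inr (inl j))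
  end.
have [s hs] := foset_and (foset_sub e1 (foset_sat M r)) (foset_sub e2 (foset_sat M p)).
apply: (pdef_definable (b := pair_tuple b (dg_emb q))); exists s => a; rewrite hs.
set b' := pair_tuple a _.
have -> : (fun i => eval b' (e1 i)) = pair_tuple a b.
  by apply: functional_extensionality_dep => -[].
have -> : (fun i => eval b' (e2 i)) = pair_tuple (pair_tuple a (dg_emb q)) b.
  by apply: functional_extensionality_dep => -[[]|].
rewrite hr; split=> [[[x ->] h]|[x hx <-]]; last first.
  by split; [exists x|apply/(hp (x, q))].
by exists x => //; apply/(hp (x, q)).
Qed.

(** The hypothesis on connected components speaks of definable groups, so a definable subgroup has
    to become one in its own right, in the same coordinates. *)
Lemma subgroup_definable H (sH : subgroup H) : dpred (X := GG) H ->
  exists G' : definable_group M, exists2 h : G' -> G,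
    [/\ injective h, forall x, H (h x), forall x, H x -> exists y, h y = x
      & {morph h : x y / x * y}] &
    forall K : set G', definable_subset K <-> definable_subset (h @` K).
Proof.
move=> dH; pose h := @subgroup_val _ _ sH.
pose emb x := dg_emb (h x).
have imE (K : set (subgroup_group sH)) : emb @` K = @dg_emb _ _ G @` (h @` K).
  by rewrite -image_comp.
have inj : injective emb by move=> x y /dg_inj /subgroup_val_inj.
have hH : range h = H.
  apply/seteqP; split=> [_ [x _ <-]|x /(subgroup_val_surj sH)[y <-]].
    exact: subgroup_valP.
  by exists y.
have rng : definable (range emb).
  by rewrite imE hH; apply: dpred_definable.
have mul : definable (graph2 emb (fun x y => x * y)).
  have : dpred (fun z : dprod (dprod GG GG) GG => (H z.1.1 /\ H z.1.2) /\
           z.1.1 * z.1.2 = z.2).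
    apply: dpred_and; last by apply: dpred_eqg; dterm.
    by apply: dpred_and; apply: (dpred_mem (K := H)) => //; dterm.
  rewrite dpred_image => /pdef_definable; congr definable.
  apply/funext => c; apply/propext; split=> [[[[x y] z] /= [[]]]|[x [y ->]]].
    move=> /(subgroup_val_surj sH)[x' <-] /(subgroup_val_surj sH)[y' <-] <- <-.
    by exists x', y'.
  exists ((h x, h y), h x * h y) => //.
  by split=> //; split; apply: subgroup_valP.
exists (DefinableGroup inj rng mul), h.
  by split=> //; [exact: subgroup_val_inj|exact: subgroup_valP|exact: subgroup_val_surj].
by move=> K; rewrite /definable_subset -imE.
Qed.

Hypothesis cc : forall G' : definable_group M, has_connected_component G'.

Lemma connected_component H : subgroup H -> dpred (X := GG) H ->
  exists N, component_of N H.
Proof.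
move=> sH dH; have [G' [h [inj hH sur hM] hdef]] := subgroup_definable sH dH.
have h1 : h 1 = 1 by apply: (mulgI (h 1)); rewrite -hM !mulg1.
have hV x : h x^-1 = (h x)^-1.
  by symmetry; apply: mulg1_eq; rewrite -hM mulgV.
have [N [sN dN /(finite_index_fin_idx sN)[n [f hf]] minN]] := cc G'.
have [g hg] : exists g : G -> G', forall x, H x -> h (g x) = x.
  have h' x : exists y, H x -> h y = x.
    have [/sur[y]|no] := pselect (H x); first by exists y.
    by exists 1.
  by have [g hg] := choice h'; exists g.
exists (h @` N); split.
- case: sN => N1 NM NV; split; first by exists 1.
    by move=> _ _ [x Nx <-] [y Ny <-]; exists (x * y); rewrite ?hM //; apply: NM.
  by move=> _ [x Nx <-]; exists x^-1; rewrite ?hV //; apply: NV.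
- by move=> _ [x _ <-].
- exact/hdef.
- exists n, (f \o g) => x y Hx Hy /= e; exists ((g x)^-1 * g y); first exact: hf.
  by rewrite hM hV !hg.
- move=> K sK dK KH [m [f' hf']] _ [x Nx <-].
  have [K1 KM KV] := sK.
  apply: (minN (h @^-1` K)) => //=.
  + by split=> [|y z|y] /=; rewrite ?h1 ?hM ?hV //; [apply: KM|apply: KV].
  + apply/hdef; suff -> : h @` (h @^-1` K) = K by [].
    apply/seteqP; split=> [_ [y Ky <-] //|y Ky].
    by have [z e] := sur y (KH _ Ky); exists z; rewrite /= ?e.
  + apply/finite_index_fin_idx.
      by split=> [|y z|y] /=; rewrite ?h1 ?hM ?hV //; [apply: KM|apply: KV].
    by exists m, (f' \o h) => y z _ _ /= e; rewrite hM hV; apply: hf'.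
Qed.

End Base.
End Connected.

(** * Quotients of definable sets in [M^eq] *)

Section Meq.
Variables (L : language) (M : structure L).

Definition home I (w : I -> sorts L) : I -> sorts (meq_language M) :=
  fun i => inl (w i).

Lemma meq_term I (w : I -> sorts L) s (t : term w s) :
  exists t' : term (home w) (inl s : sorts (meq_language M)),
    forall a : tup M w, eval (a : tup (meq M) (home w)) t' = eval a t.
Proof.
elim: t => [i|f t IH]; first by exists (Var (home w) i).
have {IH} IH i : {t' : term (home w) (inl (fdom L f i) : sorts (meq_language M)) |
    forall a : tup M w, eval (a : tup (meq M) (home w)) t' = eval a (t i)} by apply: cid.
exists (App (L := meq_language M) (f := inl f) (fun i => sval (IH i))) => a /=.
congr (fint M f); apply: functional_extensionality_dep => i.
exact: (svalP (IH i)).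
Qed.

Lemma foset_meq I (w : I -> sorts L) (A : tup M w -> Prop) :
  foset A -> foset (A : tup (meq M) (home w) -> Prop).
Proof.
case=> p hp.
suff h : foset (fun a : tup (meq M) (home w) => sat p (a : tup M w)).
  exact: foset_iff h hp.
move=> {A hp}.
elim: p => {I w} [I w|I w s t u|I w r t|I w p IHp q IHq|I w s p IH] /=.
- exact: foset_false.
- have [t' ht] := meq_term t; have [u' hu] := meq_term u.
  by apply: foset_iff (foset_eq _ t' u') _ => a; rewrite ht hu.
- have h i : {t' : term (home w) (inl (rdom L r i) : sorts (meq_language M)) |
    forall a : tup M w, eval (a : tup (meq M) (home w)) t' = eval a (t i)}.
    by apply: cid; exact: meq_term.
  exists (Rel (L := meq_language M) (r := r) (fun i => sval (h i))) => a /=.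
  split; congr (rint M r _); apply: functional_extensionality_dep => i;
    [|symmetry]; exact: (svalP (h i)).
- exact: foset_imp.
- pose w' := ext (home w) (inl s : sorts (meq_language M)).
  pose e o : term w' (home (ext w s) o) :=
    match o return term w' (home (ext w s) o) with
    | Some i => Var w' (Some i) | None => Var w' None end.
  apply: foset_iff (foset_all (foset_sub e IH)) _ => a.
  split=> h x; have := h x; congr (sat p _);
    by apply: functional_extensionality_dep => -[].
Qed.

Lemma er_classP (E : Defs.eqrel M) (a a' : tup M (@er_ctx _ _ E)) :
  er_class a = er_class a' <-> er_rel a a'.
Proof.
split=> [/(congr1 sval) /= ->|h]; first exact: er_refl.
apply: sval_inj; apply/funext => c; apply/propext; split.
  by apply: er_trans; apply: er_sym.
exact: er_trans.
Qed.

Section Params.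
Variables (J : finType) (v : J -> sorts L) (b : tup M v).

Section Power.
Variables (K : finType) (X : dtype b).

Let w (ki : K * dt_idx X) := dt_ctx ki.2.
Let emb (x : K -> X) : tup M w := fun ki => dt_emb (x ki.1) ki.2.

Let emb_inj : injective emb.
Proof.
move=> x y e; apply/funext => k; apply: dt_inj.
apply: functional_extensionality_dep => i.
exact: (f_equal (fun t => t (k, i)) e).
Qed.

Let emb_range : pdef b (fun a => exists x, a = emb x).
Proof.
have [p hp] := dt_range X.
pose w' := pair_ctx w v.
pose e k i : term w' (pair_ctx (@dt_ctx _ _ _ _ b X) v i) :=
  match i with inl i => Var w' (inl (k, i)) | inr j => Var w' (inr j) end.
have [q hq] : foset (fun a : tup M w' => forall k, sat p (fun i => eval a (e k i))).
  by apply: foset_forall_fin => k; apply: foset_sub (foset_sat M p).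
exists q => a; rewrite hq.
have E k : (fun i => eval (pair_tuple a b) (e k i)) = pair_tuple (fun i => a (k, i)) b.
  by apply: functional_extensionality_dep => -[].
split=> [h|[x ex] k]; last by rewrite E hp; exists (x k); rewrite ex.
have {}h k : exists x, (fun i => a (k, i)) = dt_emb x by apply/hp; rewrite -E.
have [x hx] := choice h; exists x.
apply: functional_extensionality_dep => -[k i].
exact: (f_equal (fun t => t i) (hx k)).
Qed.

(** An arbitrary finite exponent lets a single argument about [M^eq] serve both the range of an
    embedding (one variable) and the graphs of operations (three). *)
Definition dpow : dtype b := Dtype emb_inj emb_range.

Lemma sfun_proj k : sfun (fun x : dpow => x k : X).
Proof. by exists (fun i => Var w (k, i)). Qed.

End Power.

Variables (X : dtype b) (eqX : X -> X -> Prop).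
Hypothesis eqX_def : dpred (fun z : dprod X X => eqX z.1 z.2).
Hypothesis eqX_sym : forall x y, eqX x y -> eqX y x.
Hypothesis eqX_trans : forall x y z, eqX x y -> eqX y z -> eqX x z.

Let u := pair_ctx (@dt_ctx _ _ _ _ b X) v.
Let n := #|{: dt_idx X + J}|.
Let w0 (i : 'I_n) := u (enum_val i).
Let code (x : X) : tup M w0 := fun i => pair_tuple (dt_emb x) b (enum_val i).

(* The parameters are part of the coded tuple, and the relation compares the
   classes [{z | eqX x z}]; it is thus an equivalence relation for any choice
   of the parameters. *)
Let eqrel_code : exists p : formula (pair_ctx w0 w0),
  [/\ forall a, sat (M := M) p (pair_tuple a a),
      forall a a', sat (M := M) p (pair_tuple a a') -> sat (M := M) p (pair_tuple a' a),
      forall a1 a2 a3, sat (M := M) p (pair_tuple a1 a2) ->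
        sat (M := M) p (pair_tuple a2 a3) -> sat (M := M) p (pair_tuple a1 a3)
    & forall x y, sat p (pair_tuple (code x) (code y)) <-> (forall z, eqX x z <-> eqX y z)].
Proof.
have /dpred_image[p hp] := eqX_def.
pose w := @dt_ctx _ _ _ _ b X.
(* Here [t] consists of a candidate element and parameters. [F y t] says that [y] codes, with these
   same parameters, an element related by [p] to the candidate; so [F y] plays the role of the class
   of [y], even for foreign parameters. *)
pose F (y : tup M w0) (t : tup M u) := exists a : tup M w,
  (forall i, y i = pair_tuple a (fun j => t (inr j)) (enum_val i)) /\
  sat p (pair_tuple (pair_tuple a (fun i => t (inl i))) (fun j => t (inr j))).
have fF : foset (fun a : tup M (pair_ctx w0 u) => F (fun i => a (inl i)) (fun k => a (inr k))).
  pose w' := pair_ctx (pair_ctx w0 u) w.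
  pose e3 k : term w' (u k) :=
    match k return term w' (u k) with
    | inl i => Var w' (inr i) | inr j => Var w' (inl (inr (inr j))) end.
  pose e4 k : term w' (pair_ctx (pair_ctx w w) v k) :=
    match k with
    | inl (inl i) => Var w' (inr i)
    | inl (inr i) => Var w' (inl (inr (inl i)))
    | inr j => Var w' (inl (inr (inr j)))
    end.
  have h := foset_exists_tup (foset_and
    (foset_forall_fin (fun i => foset_eq M (Var w' (inl (inl i))) (e3 (enum_val i))))
    (foset_sub e4 (foset_sat M p))).
  apply: foset_iff h _ => a; rewrite /F.
  have E3 y i : eval (pair_tuple a y) (e3 (enum_val i)) =
      pair_tuple y (fun j => a (inr (inr j))) (enum_val i) by case: (enum_val i).
  have E4 y : (fun i => eval (pair_tuple a y) (e4 i)) =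
      pair_tuple (pair_tuple y (fun i => a (inr (inl i)))) (fun j => a (inr (inr j))).
    by apply: functional_extensionality_dep => -[[]|].
  by split=> -[y [h1 h2]]; exists y; (split=> [i|]; [have := h1 i|move: h2]);
    rewrite ?E3 ?E4.
have [q hq] : foset (fun a : tup M (pair_ctx w0 w0) => forall t : tup M u,
    (F (fun i => a (inl i)) t -> F (fun i => a (inr i)) t) /\
    (F (fun i => a (inr i)) t -> F (fun i => a (inl i)) t)).
  pose w' := pair_ctx (pair_ctx w0 w0) u.
  pose e1 k : term w' (pair_ctx w0 u k) :=
    match k with inl i => Var w' (inl (inl i)) | inr j => Var w' (inr j) end.
  pose e2 k : term w' (pair_ctx w0 u k) :=
    match k with inl i => Var w' (inl (inr i)) | inr j => Var w' (inr j) end.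
  have f1 := foset_sub e1 fF; have f2 := foset_sub e2 fF.
  exact: foset_forall_tup (foset_and (foset_imp f1 f2) (foset_imp f2 f1)).
exists q; split=> [a|a a'|a1 a2 a3|x y]; rewrite ?hq.
- by move=> t; split.
- by move=> h t; have [] := h t.
- by move=> h1 h2 t; have [h3 h4] := h1 t; have [h5 h6] := h2 t; split=> [/h3|/h6].
have FE z t : F (code z) t <-> exists2 z', eqX z z' & t = pair_tuple (dt_emb z') b.
  split=> [[a [h1 h2]]|[z' zz' ->]]; last first.
    by exists (dt_emb z); split=> //; apply/hp; exists (z, z').
  have /pair_tuple_inj[ea eb] : pair_tuple (dt_emb z) b = pair_tuple a (fun j => t (inr j)).
    apply: functional_extensionality_dep => k.
    by rewrite -(enum_rankK k); exact: h1.
  move: h2; rewrite -ea -eb => /hp[[z1 z2] /= h /pair_tuple_inj[/dt_inj /= e1 /= e2]].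
  exists z2; first by rewrite -e1.
  by rewrite [t]pair_tuple_eta -eb e2.
split=> [h z|h t].
  by have [h1 h2] := h (pair_tuple (dt_emb z) b); split=> hz;
    [have /h1/FE[z' h3 /pair_tuple_inj[/dt_inj -> _]] // : F (code x) (pair_tuple (dt_emb z) b)
    |have /h2/FE[z' h3 /pair_tuple_inj[/dt_inj -> _]] // : F (code y) (pair_tuple (dt_emb z) b)];
    apply/FE; exists z.
by split=> /FE[z hz ->]; apply/FE; exists z => //; apply/h.
Qed.

Variables (R : rng) (lift : R -> X).
Hypothesis lift_refl : forall r, eqX (lift r) (lift r).
Hypothesis lift_inj : forall r s, eqX (lift r) (lift s) -> r = s.
Hypothesis lift_def : dpred (fun x => exists r, eqX (lift r) x).

Let graph (op : R -> R -> R) (x y z : X) :=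
  exists r s, [/\ eqX (lift r) x, eqX (lift s) y & eqX (lift (op r s)) z].
Hypothesis add_def : dpred (fun z : dprod (dprod X X) X =>
  graph +%R z.1.1 z.1.2 z.2).
Hypothesis mul_def : dpred (fun z : dprod (dprod X X) X =>
  graph (@rng_mul R) z.1.1 z.1.2 z.2).

(** The ring itself is unchanged; only the embedding is new, [r] going to the class of [lift r] in
    one imaginary sort. [eqX] is just a partial equivalence relation, and its classes are compared
    as sets. *)
Lemma interpretable_quotient : exists R' : interpretable_ring M, dr_rng R' = R.
Proof.
have [p [prefl psym ptrans pcode]] := eqrel_code.
pose E : Defs.eqrel M := Eqrel prefl psym ptrans.
pose cls (x : X) : er_quotient E := er_class (E := E) (code x).
have clsP x y : cls x = cls y <-> (forall z, eqX x z <-> eqX y z).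
  by rewrite er_classP; exact: pcode.
have cls_eq x y : eqX x y -> cls x = cls y.
  move=> xy; apply/clsP => z; split=> h; last exact: eqX_trans h.
  by apply: eqX_trans h; apply: eqX_sym.
(* A formula about representatives in [M] remains one in [M^eq], and the class of [x] is a term
   there: the projection applied to the coordinates of [x] followed by the parameters. Quantifying
   over the representatives yields the definable sets of classes. *)
have kdef (K I : finType) (w : I -> sorts (meq_language M))
    (tK : K -> term w (inr E : sorts (meq_language M))) (P : dpow K X -> Prop) :
    dpred P -> pdef (b : tup (meq M) (home v))
      (fun c => exists2 x : K -> X, P x & forall k, eval (M := meq M) c (tK k) = cls (x k)).
  move=> /dpred_image[q hq].
  pose wX := @dt_ctx _ _ _ _ b (dpow K X).
  pose w' := pair_ctx (pair_ctx w (home v)) (home wX).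
  pose e1 j : term w' (home (pair_ctx wX v) j) :=
    match j return term w' (home (pair_ctx wX v) j) with
    | inl i => Var w' (inr i) | inr j => Var w' (inl (inr j)) end.
  pose e2 k j : term w' (inl (u j) : sorts (meq_language M)) :=
    match j return term w' (inl (u j) : sorts (meq_language M)) with
    | inl i => Var w' (inr (k, i)) | inr j => Var w' (inl (inr j)) end.
  pose tE k : term w' (inr E : sorts (meq_language M)) :=
    App (L := meq_language M) (f := inr E) (fun i => e2 k (enum_val i)).
  pose tK' k := tsub (fun i => Var w' (inl (inl i))) (tK k).
  have [r hr] := foset_exists_tup (foset_and
    (foset_sub e1 (foset_meq (foset_sat M q)))
    (foset_forall_fin (fun k => foset_eq (meq M) (tK' k) (tE k)))).
  exists r => c; rewrite hr.
  have E1 y : (fun i => eval (M := meq M)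
      (pair_tuple (pair_tuple c (b : tup (meq M) (home v))) y) (e1 i)) =
      pair_tuple (M := M) y b by apply: functional_extensionality_dep => -[].
  have E2 (x : K -> X) k : eval (M := meq M) (pair_tuple (pair_tuple c (b : tup (meq M) (home v)))
        (dt_emb (d := dpow K X) x : tup (meq M) (home wX))) (tE k) = cls (x k).
    set c' := pair_tuple _ _.
    have E3 j : eval c' (e2 k j) = pair_tuple (dt_emb (x k)) b j by case: j.
    rewrite /cls /tE /=; congr er_class; apply: functional_extensionality_dep => i.
    exact: E3.
  have EK y k : eval (M := meq M)
      (pair_tuple (pair_tuple c (b : tup (meq M) (home v))) y) (tK' k) = eval c (tK k).
    by rewrite eval_tsub.
  split=> [[y]|[x Px hx]].
    rewrite E1 => -[/hq[x Px <-] h]; exists x => // k.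
    by rewrite -E2 -h EK.
  exists (dt_emb (d := dpow K X) x); rewrite E1; split; first by apply/hq; exists x.
  by move=> k; rewrite E2 EK.
pose w1 (_ : 'I_1) : sorts (meq_language M) := inr E.
pose emb (r : R) : tup (meq M) w1 := fun=> cls (lift r).
have emb_inj : injective emb.
  move=> r s e; have /clsP h := f_equal (fun t => t ord0) e.
  by apply: lift_inj; apply/h; exact: lift_refl.
have emb_eq (c c' : tup (meq M) w1) : c ord0 = c' ord0 -> c = c'.
  by move=> e; apply: functional_extensionality_dep => i; rewrite (ord1 i).
have rng : definable (range emb).
  have := kdef _ _ w1 (fun _ : unit => Var w1 ord0) _
    (dpred_sfun (sfun_proj X (tt : unit)) lift_def).
  move=> /pdef_definable; congr definable; apply/seteqP; split=> c.
    move=> [x [r hr] /(_ tt) /= hx]; exists r => //; apply: emb_eq.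
    by rewrite hx; apply: cls_eq.
  by move=> [r _ <-]; exists (fun=> lift r) => //; exists r.
have gdef op : dpred (fun z : dprod (dprod X X) X => graph op z.1.1 z.1.2 z.2) ->
    definable (graph2 emb op).
  move=> h; pose w3 := pair_ctx (pair_ctx w1 w1) w1.
  pose tK (k : unit + unit + unit) : term w3 (inr E : sorts (meq_language M)) :=
    match k with
    | inl (inl _) => Var w3 (inl (inl ord0))
    | inl (inr _) => Var w3 (inl (inr ord0))
    | inr _ => Var w3 (inr ord0)
    end.
  have := kdef _ _ w3 tK _ (dpred_sfun (sfun_pair (sfun_pair
    (sfun_proj X (inl (inl tt) : unit + unit + unit)) (sfun_proj X (inl (inr tt))))
    (sfun_proj X (inr tt))) h).
  move=> /pdef_definable; congr definable; apply/seteqP; split=> c.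
    move=> [x [r [s [/= h1 h2 h3]]] hx]; exists r, s.
    rewrite [c]pair_tuple_eta [X in pair_tuple X _]pair_tuple_eta.
    congr (pair_tuple (pair_tuple _ _) _); apply: emb_eq.
    + by rewrite [LHS](hx (inl (inl tt))); symmetry; apply: cls_eq.
    + by rewrite [LHS](hx (inl (inr tt))); symmetry; apply: cls_eq.
    + by rewrite [LHS](hx (inr tt)); symmetry; apply: cls_eq.
  move=> [r [s ->]]; exists (fun k => match k with
    | inl (inl _) => lift r | inl (inr _) => lift s | inr _ => lift (op r s) end).
    by exists r, s.
  by move=> [[]|].
by exists (DefinableRing emb_inj rng (gdef _ add_def) (gdef _ mul_def)).
Qed.

End Params.
End Meq.

(** * Abelian quotients and the ring of a cyclic module *)

Section AbelianQuotient.
Local Open Scope group_scope.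
Variables (T : groupType) (A B : set T).
Hypotheses (sA : subgroup A) (sB : subgroup B).
Hypothesis BJ : forall x y, B x -> A y -> B (x ^ y).
Hypothesis AB : forall x y, A x -> A y -> B [~ x, y].
Hypothesis BA : B `<=` A.

(** A chosen element of the coset of [x]: the quotient becomes the subtype of those elements of [A]
    that represent themselves. *)
Let rep x : T := xget 1 [set y | B (x^-1 * y)].
Local Notation V := {x : T | `[< A x /\ rep x = x >]}.

Let repP x : B (x^-1 * rep x).
Proof.
have : [set y | B (x^-1 * y)] (rep x).
  by apply: (@xgetI _ _ _ x); rewrite /= mulVg; case: sB.
by [].
Qed.

Let rep_eq x y : B (x^-1 * y) -> rep x = rep y.
Proof.
have [B1 BM BV] := sB.
move=> h; congr (xget 1 _); apply/funext => z; apply/propext; split=> /= h'.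
  have := BM _ _ (BV _ h) h'.
  by rewrite invgM invgK -mulgA mulVKg.
by have := BM _ _ h h'; rewrite -mulgA mulVKg.
Qed.

Let repA x : A x -> A (rep x).
Proof.
have [_ AM _] := sA.
by move=> hx; rewrite -(mulVKg x (rep x)); apply: AM => //; apply/BA/repP.
Qed.

Let piP x : A x -> `[< A (rep x) /\ rep (rep x) = rep x >].
Proof.
move=> hx; apply/asboolP; split; first exact: repA.
by symmetry; apply/rep_eq/repP.
Qed.

Let A1 : A 1. Proof. by case: sA. Qed.

Let pi x : V := insubd (exist _ (rep 1) (piP A1) : V) (rep x).

Let val_pi x : A x -> val (pi x) = rep x.
Proof. by move=> hx; rewrite /pi insubdK //; exact: piP. Qed.

Let mem_val (u : V) : A (val u).
Proof. by have /asboolP[] := valP u. Qed.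

Let piK (u : V) : pi (val u) = u.
Proof.
apply: val_inj; rewrite val_pi; last exact: mem_val.
by have /asboolP[] := valP u.
Qed.

Let pi_eq x y : A x -> A y -> pi x = pi y <-> B (x^-1 * y).
Proof.
have [B1 BM BV] := sB.
move=> hx hy; split=> [/(congr1 val)|h]; last first.
  by apply: val_inj; rewrite !val_pi //; apply: rep_eq.
rewrite !val_pi // => e.
have := BM _ _ (repP x) (BV _ (repP y)); rewrite e invgM invgK.
by rewrite -mulgA mulVKg.
Qed.

Let add (u w : V) : V := pi (val u * val w).
Let opp (u : V) : V := pi (val u)^-1.

Let pi_mul x y : A x -> A y -> pi (x * y) = add (pi x) (pi y).
Proof.
have [_ AM _] := sA; have [_ BM _] := sB.
move=> hx hy; apply/pi_eq; try by apply: AM => //; exact: mem_val.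
rewrite !val_pi // invgM -mulgA (mulgA x^-1).
have -> : y^-1 * (x^-1 * rep x * rep y) = (x^-1 * rep x) ^ y * (y^-1 * rep y).
  by rewrite /conjg -!mulgA mulVKg.
by apply: BM; [apply: BJ => //; apply: repP|apply: repP].
Qed.

Let pi_ind (P : V -> Prop) : (forall x, A x -> P (pi x)) -> forall u, P u.
Proof. by move=> h u; rewrite -(piK u); apply/h/mem_val. Qed.

Let AM x y : A x -> A y -> A (x * y).
Proof. by case: sA => _ h _; apply: h. Qed.

Let addA : associative add.
Proof.
elim/pi_ind=> x hx; elim/pi_ind=> y hy; elim/pi_ind=> z hz.
by rewrite -!pi_mul ?mulgA //; apply: AM.
Qed.

Let addC : commutative add.
Proof.
elim/pi_ind=> x hx; elim/pi_ind=> y hy.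
rewrite -!pi_mul //; apply/pi_eq; [exact: AM|exact: AM|].
have [_ _ BV] := sB; rewrite invgM.
suff -> : y^-1 * x^-1 * (y * x) = [~ y, x] by apply: AB.
by rewrite /commg /conjg !mulgA.
Qed.

Let add0 : left_id (pi 1) add.
Proof. by elim/pi_ind=> x hx; rewrite -pi_mul // mul1g. Qed.

Let addN : left_inverse (pi 1) opp add.
Proof.
have [_ _ AV] := sA.
move=> u; have uA := mem_val u.
by rewrite /opp -{2}(piK u) -pi_mul ?mulVg //; exact: AV.
Qed.

Local Open Scope ring_scope.

Lemma quotient_zmodule : exists (V : zmodType) (p : T -> V) (s : V -> T),
  [/\ forall u, A (s u), forall u, p (s u) = u,
      forall x y, A x -> A y -> p (x * y)%g = p x + p y
    & forall x y, A x -> A y -> p x = p y <-> B (x^-1 * y)%g].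
Proof.
pose Vz : zmodType := HB.pack V (GRing.isZmodule.Build V addA addC add0 addN).
by exists Vz, (pi : T -> Vz), (fun u : Vz => sval u : T); split=> //; exact: mem_val.
Qed.

End AbelianQuotient.

(** * The commutative ring on an orbit of commuting operators *)

Section CyclicRing.
Local Open Scope ring_scope.
Variables (V : zmodType) (O : set (V -> V)).

(* The operators [\sum_(i < k) (o_i - o'_i)] with [o_i], [o'_i] in [O]. *)
Fixpoint sumop k : set (V -> V) :=
  if k is k'.+1 then
    [set p | exists q o o', [/\ sumop k' q, O o, O o'
                              & p = fun x => q x + (o x - o' x)]]
  else [set fun=> 0].

Hypothesis O_add : forall o, O o -> forall x y, o (x + y) = o x + o y.
Hypothesis O_comp : forall o o', O o -> O o' -> O (o \o o').
Hypothesis O_comm : forall o o', O o -> O o' -> forall x, o (o' x) = o' (o x).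

Let Rop p := exists k, sumop k p.

Let additive0 (p : V -> V) : (forall x y, p (x + y) = p x + p y) -> p 0 = 0.
Proof. by move=> h; apply: (addrI (p 0)); rewrite -h !addr0. Qed.

Let additiveN (p : V -> V) : (forall x y, p (x + y) = p x + p y) ->
  forall x, p (- x) = - p x.
Proof. by move=> h x; apply: (addrI (p x)); rewrite -h !subrr additive0. Qed.

Let Rop_add p : Rop p -> forall x y, p (x + y) = p x + p y.
Proof.
case=> k; elim: k p => [|k IH] p /=; first by move=> -> x y; rewrite addr0.
move=> [q [o [o' [/IH hq ho ho' ->]]]] x y; rewrite hq (O_add ho) (O_add ho') opprD.
by rewrite [RHS]addrACA; congr (_ + _); rewrite addrACA.
Qed.

Let RopD p q : Rop p -> Rop q -> Rop (fun x => p x + q x).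
Proof.
move=> hp [k]; elim: k q => [|k IH] q /=.
  move=> ->; case: hp => j hj; exists j; congr (sumop j _): hj.
  by apply/funext => x; rewrite addr0.
move=> [q' [o [o' [/IH[j hj] ho ho' ->]]]]; exists j.+1.
exists (fun x => p x + q' x), o, o'; split=> //.
by apply/funext => x; rewrite addrA.
Qed.

Let RopB o o' : O o -> O o' -> Rop (fun x => o x - o' x).
Proof.
move=> ho ho'; exists 1%N; exists (fun=> 0), o, o'; split=> //.
by apply/funext => x; rewrite add0r.
Qed.

Let RopN p : Rop p -> Rop (fun x => - p x).
Proof.
case=> k; elim: k p => [|k IH] p /=.
  by move=> ->; exists 0%N => /=; apply/funext => x; rewrite oppr0.
move=> [q [o [o' [/IH hq ho ho' ->]]]].
have := RopD hq (RopB ho' ho); congr Rop; apply/funext => x.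
by rewrite opprD opprB.
Qed.

Let Rop_O o p : O o -> Rop p -> Rop (o \o p).
Proof.
move=> ho [k]; elim: k p => [|k IH] p /=.
  move=> ->; exists 0%N => /=; apply/funext => x.
  by rewrite /= (additive0 (O_add ho)).
move=> [q [p1 [p2 [/IH hq h1 h2 ->]]]].
have := RopD hq (RopB (O_comp ho h1) (O_comp ho h2)); congr Rop.
by apply/funext => x /=; rewrite !(O_add ho) (additiveN (O_add ho)).
Qed.

Let Rop_comp p q : Rop p -> Rop q -> Rop (p \o q).
Proof.
move=> [k]; elim: k p => [|k IH] p /=; first by move=> -> _; exists 0%N.
move=> [p' [o [o' [hp' ho ho' ->]]]] hq.
exact: RopD (IH _ hp' hq) (RopD (Rop_O ho hq) (RopN (Rop_O ho' hq))).
Qed.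

Let Rop_commO o p : O o -> Rop p -> forall x, o (p x) = p (o x).
Proof.
move=> ho [k]; elim: k p => [|k IH] p /=.
  by move=> -> x; rewrite (additive0 (O_add ho)).
move=> [q [p1 [p2 [/IH hq h1 h2 ->]]]] x.
rewrite !(O_add ho) (additiveN (O_add ho)).
by rewrite hq (O_comm ho h1) (O_comm ho h2).
Qed.

Let Rop_comm p q : Rop p -> Rop q -> forall x, p (q x) = q (p x).
Proof.
move=> hp [k]; elim: k q => [|k IH] q /=.
  by move=> -> x; rewrite (additive0 (Rop_add hp)).
move=> [q' [p1 [p2 [/IH hq h1 h2 ->]]]] x.
have hpA := Rop_add hp; rewrite !hpA additiveN //.
by rewrite hq -(Rop_commO h1 hp) -(Rop_commO h2 hp).
Qed.

Variable v : V.
Let W w := exists2 p, Rop p & p v = w.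
Local Notation U := {w : V | `[< W w >]}.

Let memW (u : U) : W (val u). Proof. by have /asboolP := valP u. Qed.
Let mkU w (h : W w) : U := exist _ w (asboolT h).

Let addWP (x y : U) : W (val x + val y).
Proof.
have [p hp <-] := memW x; have [q hq <-] := memW y.
by exists (fun x => p x + q x) => //; apply: RopD.
Qed.

Let oppWP (x : U) : W (- val x).
Proof. by have [p hp <-] := memW x; exists (fun x => - p x) => //; apply: RopN. Qed.

Let zeroWP : W 0. Proof. by exists (fun=> 0) => //; exists 0%N. Qed.

Let addU x y : U := mkU (addWP x y).
Let oppU x : U := mkU (oppWP x).
Let zeroU : U := mkU zeroWP.

Let addUA : associative addU.
Proof. by move=> x y z; apply: val_inj; rewrite /= addrA. Qed.
Let addUC : commutative addU.
Proof. by move=> x y; apply: val_inj; rewrite /= addrC. Qed.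
Let addU0 : left_id zeroU addU.
Proof. by move=> x; apply: val_inj; rewrite /= add0r. Qed.
Let addUN : left_inverse zeroU oppU addU.
Proof. by move=> x; apply: val_inj; rewrite /= addNr. Qed.

Let Uz : zmodType := HB.pack U (GRing.isZmodule.Build U addUA addUC addU0 addUN).

Let op_of (x : U) : {p | Rop p /\ p v = val x}.
Proof. by apply: cid; have [p] := memW x; exists p. Qed.

Let mulWP (x y : U) : W (sval (op_of x) (val y)).
Proof.
have [p hp <-] := memW y; have [hx _] := svalP (op_of x).
by exists (sval (op_of x) \o p) => //; apply: Rop_comp.
Qed.

Let mulU (x y : Uz) : Uz := mkU (mulWP x y).

(** Independence of the chosen operator: with [y = q v], commutation gives [p (q v) = q (p v)],
    which depends on [p] only through [p v]. *)
Let mulUE p (x y : Uz) : Rop p -> p v = sval x -> sval (mulU x y) = p (sval y).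
Proof.
move=> hp e; have [hx ex] := svalP (op_of x).
have [q hq ey] := memW y; rewrite [LHS]/= -!ey.
rewrite (Rop_comm hx hq) (Rop_comm hp hq) e.
by congr (q _); exact: ex.
Qed.

Let mulUC : commutative mulU.
Proof.
move=> x y; apply: sval_inj; have [p hp ex] := memW x; have [q hq ey] := memW y.
by rewrite (mulUE y hp ex) (mulUE x hq ey) -[sval x]ex -[sval y]ey Rop_comm.
Qed.

Let mulUA : associative mulU.
Proof.
move=> x y z; apply: sval_inj; have [p hp ex] := memW x; have [q hq ey] := memW y.
have h : (p \o q) v = sval (mulU x y) by rewrite (mulUE y hp ex) /= ey.
by rewrite (mulUE _ hp ex) (mulUE _ hq ey) (mulUE _ (Rop_comp hp hq) h).
Qed.

Let mulUDr : right_distributive mulU +%R.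
Proof.
move=> x y z; apply: val_inj; have [p hp ex] := memW x.
have E (t : Uz) : val (mulU x t) = p (sval t) := mulUE t hp ex.
transitivity (val (mulU x y) + val (mulU x z)); last by [].
by rewrite !E -(Rop_add hp).
Qed.

Let mulUDl : left_distributive mulU +%R.
Proof. by move=> x y z; rewrite mulUC mulUDr !(mulUC z). Qed.

Lemma cyclic_ring : exists (R : rng) (i : R -> V),
  [/\ injective i, forall x y, i (x + y) = i x + i y,
      forall w, (exists r, i r = w) <-> (exists k p, sumop k p /\ p v = w),
      forall k p x y, sumop k p -> p v = i x -> i (rng_mul x y) = p (i y)
    & rng_commutative R].
Proof.
exists (Rng mulUA mulUDl mulUDr), (fun x : Uz => sval x); split=> //.
- by move=> x y; apply: val_inj.
- move=> w; split=> [[x <-]|[k [p [hp e]]]].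
    by have [p [k hp] e] := memW x; exists k, p.
  have h : W w by exists p => //; exists k.
  by exists (mkU h).
- by move=> k p x y hp e; apply: mulUE => //; exists k.
Qed.

End CyclicRing.

(** * Action of a connected group on an abelian section *)

Section HypercentralSeries.
Local Open Scope group_scope.
Variables (T : groupType) (H A B : set T).

(* [A / B] is an abelian section of [H] on which [H] acts as an abelian group. *)
Record abelian_section : Prop := AbelianSection {
  as_sH : subgroup H;
  as_sA : subgroup A;
  as_sB : subgroup B;
  as_AH : A `<=` H;
  as_BA : B `<=` A;
  as_AJ : forall x g, A x -> H g -> A (x ^ g);
  as_BJ : forall x g, B x -> H g -> B (x ^ g);
  as_AB : forall x y, A x -> A y -> B [~ x, y];
  as_comm : forall x g h, A x -> H g -> H h -> B ((x ^ (g * h))^-1 * x ^ (h * g))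
}.

(** In [A / B], written additively, [[~ x, g]] is [(g - 1) x]; this is the preimage of the submodule
    killed by all [k]-fold products of operators [g - 1] with [g] in [H]. *)
Fixpoint hypercentral k : set T :=
  if k is k'.+1 then [set x | A x /\ forall g, H g -> hypercentral k' [~ x, g]] else B.

Hypothesis sec : abelian_section.

Lemma commgM_l (x y g : T) : [~ x * y, g] = [~ x, g] ^ y * [~ y, g].
Proof. by rewrite /commg conjMg /conjg !invgM -!mulgA ?mulKg ?mulVKg ?mulKg ?mulVKg. Qed.

Lemma commgV_l (x g : T) : [~ x^-1, g] = ([~ x, g]^-1) ^ x^-1.
Proof.
by rewrite /commg /conjg !invgM !invgK -!mulgA ?mulKg ?mulVKg ?mulKg ?mulVKg mulgV mulg1.
Qed.

Lemma commgM_r (x g h : T) : [~ x, g * h] = [~ x, h] * [~ x, g] ^ h.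
Proof. by rewrite /commg /conjg !invgM -!mulgA ?mulKg ?mulVKg ?mulKg ?mulVKg. Qed.

Lemma commgV_r (x g : T) : [~ x, g^-1] = ([~ x, g]^-1) ^ g^-1.
Proof. by rewrite /commg /conjg !invgM !invgK -!mulgA ?mulKg ?mulVKg ?mulKg ?mulVKg. Qed.

Lemma hypercentralP k : subgroup (hypercentral k) /\
  forall x g, hypercentral k x -> H g -> hypercentral k (x ^ g).
Proof.
have [H1 HM HV] := as_sH sec; have [A1 AM AV] := as_sA sec.
elim: k => [|k [[C1 CM CV] CJ]]; first by split; [exact: as_sB|exact: as_BJ].
split; first split=> [|x y|x].
- by split=> // g _; rewrite comm1g.
- move=> [Ax hx] [Ay hy]; split=> [|g Hg]; first exact: AM.
  rewrite commgM_l; apply: CM; last exact: hy.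
  by apply: CJ; [exact: hx|exact: as_AH].
- move=> [Ax hx]; split=> [|g Hg]; first exact: AV.
  rewrite commgV_l; apply: CJ; first exact/CV/hx.
  by apply/HV; apply: as_AH Ax.
- move=> x g [Ax hx] Hg; split=> [|h Hh]; first exact: as_AJ.
  rewrite -(conjgKV g h) -conjRg; apply: CJ => //; apply: hx.
  by rewrite /conjg invgK; apply: (HM _ _ Hg); apply: HM => //; apply: HV.
Qed.

(** By [commgM_r] the map from [g] to [[~ x, g]] is a crossed homomorphism, and [hypercentral k] is
    stable under conjugation by [H]. *)
Lemma subgroup_stabilizer k x : A x ->
  subgroup [set g | H g /\ hypercentral k [~ x, g]].
Proof.
move=> Ax; have [[C1 CM CV] CJ] := hypercentralP k.
have [H1 HM HV] := as_sH sec.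
split=> [|g h [Hg hg] [Hh hh]|g [Hg hg]] /=.
- by rewrite commg1.
- by split; [exact: HM|rewrite commgM_r; apply: CM => //; apply: CJ].
- by split; [exact: HV|rewrite commgV_r; apply: CJ; [exact: CV|exact: HV]].
Qed.

End HypercentralSeries.

(** * Interpretability of the ring attached to an element *)

Section Pointwise.
Variables (S : signature) (M : structure S).
Hypothesis oM : omega_categorical M.
Variable G : definable_group M.
Variables (J : finType) (v : J -> sorts S) (b : tup M v).
Hypothesis base : group_base G b.
Local Notation GG := (gdtype base).
Local Open Scope group_scope.
Variables (H A B : set G).
Hypothesis sec : abelian_section H A B.
Hypotheses (dH : dpred (X := GG) H) (dA : dpred (X := GG) A) (dB : dpred (X := GG) B).

Lemma dpred_hypercentral k : dpred (X := GG) (hypercentral H A B k).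
Proof.
elim: k => //= k IH; apply: dpred_and => //; apply: (dpred_all (Y := GG)); apply: dpred_imp.
  by apply: (dpred_mem (K := H)) => //; dterm.
by apply: (dpred_mem (K := hypercentral H A B k)) => //; dterm.
Qed.

Lemma definable_stabilizer k x :
  definable_subset [set g | H g /\ hypercentral H A B k [~ x, g]].
Proof.
apply: (definable_section (base := base)
  (P := fun g x => H g /\ hypercentral H A B k [~ x, g])).
apply: dpred_and; first by apply: (dpred_mem (K := H)) => //; dterm.
by apply: (dpred_mem (K := hypercentral H A B k)) => //; [dterm|exact: dpred_hypercentral].
Qed.

Local Open Scope ring_scope.
Variables (V : zmodType) (p : G -> V) (s : V -> G).
Hypothesis s_mem : forall u, A (s u).
Hypothesis sK : forall u, p (s u) = u.
Hypothesis pM : forall x y, A x -> A y -> p (x * y)%g = p x + p y.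
Hypothesis pE : forall x y, A x -> A y -> p x = p y <-> B (x^-1 * y)%g.

Let act (g : G) (u : V) : V := p (s u ^ g)%g.
Let O : set (V -> V) := [set act g | g in H].

Let AJ x g : A x -> H g -> A (x ^ g)%g. Proof. exact: as_AJ sec _ _. Qed.
Let AM x y : A x -> A y -> A (x * y)%g.
Proof. by have [_ h _] := as_sA sec; apply: h. Qed.
Let AV x : A x -> A x^-1%g. Proof. by have [_ _ h] := as_sA sec; apply: h. Qed.
Let A1 : A 1%g. Proof. by case: (as_sA sec). Qed.
Let HM x y : H x -> H y -> H (x * y)%g.
Proof. by have [_ h _] := as_sH sec; apply: h. Qed.
Let HV x : H x -> H x^-1%g. Proof. by have [_ _ h] := as_sH sec; apply: h. Qed.
Let H1 : H 1%g. Proof. by case: (as_sH sec). Qed.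

Let p1 : p 1%g = 0.
Proof. by apply: (addrI (p 1%g)); rewrite -pM // mulg1 addr0. Qed.

Let pV x : A x -> p x^-1%g = - p x.
Proof.
by move=> hx; have hV := AV hx; apply: (addrI (p x)); rewrite -pM // mulgV p1 subrr.
Qed.

Let actE x g : A x -> H g -> act g (p x) = p (x ^ g)%g.
Proof.
move=> hx hg; apply/pE; try exact: AJ.
rewrite -conjVg -conjMg; apply: (as_BJ sec) => //.
by apply/pE.
Qed.

Let act1 u : act 1%g u = u.
Proof. by rewrite /act conjg1. Qed.

Let actM g h u : H g -> H h -> act (g * h)%g u = act h (act g u).
Proof.
move=> hg hh; have hgh := HM hg hh; have hu := AJ (s_mem u) hg.
by rewrite -[u]sK !actE // conjgM.
Qed.

Let O_add o : O o -> forall x y, o (x + y) = o x + o y.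
Proof.
move=> [g hg <-] x y; have hxy := AM (s_mem x) (s_mem y).
rewrite -[x]sK -[y]sK -pM // !actE // conjMg pM //; exact: AJ.
Qed.

Let O_comp o o' : O o -> O o' -> O (o \o o').
Proof.
move=> [g hg <-] [h hh <-]; exists (h * g)%g; first exact: HM.
by apply/funext => u; rewrite actM.
Qed.

Let O_comm o o' : O o -> O o' -> forall x, o (o' x) = o' (o x).
Proof.
move=> [g hg <-] [h hh <-] u; have h1 := HM hg hh; have h2 := HM hh hg.
rewrite -!actM // -[u]sK !actE //; apply/pE; [exact: AJ|exact: AJ|].
exact: (as_comm sec).
Qed.

(** One operator seen through two of its values. With [a] as first argument, [((a, x), (y, z))] says
    that some operator taking [a] to [x] takes [y] to [z], which is the graph of the product once
    [k] is allowed to vary. *)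
Let relk k (z : dprod (dprod GG GG) (dprod GG GG)) :=
  [/\ A z.1.1, A z.1.2, A z.2.1 & A z.2.2] /\
  exists q, [/\ sumop O k q, q (p z.1.1) = p z.1.2 & q (p z.2.1) = p z.2.2].

Let dpred_relk k : dpred (relk k).
Proof.
have dmem : dpred (fun z : dprod (dprod GG GG) (dprod GG GG) =>
    [/\ A z.1.1, A z.1.2, A z.2.1 & A z.2.2]).
  apply: (dpred_iff (P := fun z : dprod (dprod GG GG) (dprod GG GG) =>
    (A z.1.1 /\ A z.1.2) /\ (A z.2.1 /\ A z.2.2))).
    by apply: dpred_and; apply: dpred_and; apply: (dpred_mem (K := A)) => //; dterm.
  by move=> z; split=> [[[h1 h2] [h3 h4]]|[h1 h2 h3 h4]]; split.
elim: k => [|k IH].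
  apply: (dpred_iff (P := fun z : dprod (dprod GG GG) (dprod GG GG) =>
    [/\ A z.1.1, A z.1.2, A z.2.1 & A z.2.2] /\ (B z.1.2 /\ B z.2.2))).
    apply: dpred_and => //.
    by apply: dpred_and; apply: (dpred_mem (K := B)) => //; dterm.
  have B0 y : A y -> B y <-> 0 = p y.
    by move=> hy; rewrite -p1 pE // invg1 mul1g.
  case=> -[x y] [x' y'] /=; split=> -[[/= h1 h2 h3 h4]].
    by move=> [/B0 e1 /B0 e2]; split=> //; exists (fun=> 0); split=> //; [exact: e1|exact: e2].
  by move=> [q [/= -> e1 e2]]; split=> //; split; apply/B0.
apply: (dpred_iff (P := fun z : dprod (dprod GG GG) (dprod GG GG) =>
  [/\ A z.1.1, A z.1.2, A z.2.1 & A z.2.2] /\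
  exists y0 y0' g h : GG, (relk k ((z.1.1, y0), (z.2.1, y0')) /\ (H g /\ H h)) /\
   (B (z.1.2^-1 * (y0 * (z.1.1 ^ g * (z.1.1 ^ h)^-1)))%g /\
    B (z.2.2^-1 * (y0' * (z.2.1 ^ g * (z.2.1 ^ h)^-1)))%g))).
  apply: dpred_and => //; do 4 apply: dpred_ex; apply: dpred_and.
    apply: dpred_and.
      by apply: dpred_comp IH; dterm.
    by apply: dpred_and; apply: (dpred_mem (K := H)) => //; dterm.
  by apply: dpred_and; apply: (dpred_mem (K := B)) => //; dterm.
have key x y y0 g h : A x -> A y -> A y0 -> H g -> H h ->
    B (y^-1 * (y0 * (x ^ g * (x ^ h)^-1)))%g <->
    p y0 + (act g (p x) - act h (p x)) = p y.
  move=> hx hy hy0 hg hh.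
  have hgA := AJ hx hg; have hhA := AV (AJ hx hh).
  rewrite -pE //; last by do 2 apply: AM => //.
  rewrite pM //; last exact: AM.
  rewrite pM // pV; last exact: AJ.
  by rewrite !actE //; split=> ->.
case=> -[x y] [x' y'] /=; split=> -[[h1 h2 h3 h4]].
  move=> [y0 [y0' [g [h [[[[/= _ a1 _ a2] [q [hq e1 e2]]] [hg hh]] [/key k1 /key k2]]]]]].
  split=> //; exists (fun z => q z + (act g z - act h z)); split.
  - by exists q, (act g), (act h); split=> //; [exists g|exists h].
  - by rewrite /= e1; apply: k1.
  - by rewrite /= e2; apply: k2.
move=> [q [[q0 [o [o' [hq0 [g hg <-] [h hh <-] ->]]]] /= e1 e2]]; split=> //.
exists (s (q0 (p x))), (s (q0 (p x'))), g, h; split.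
  split=> //; split; first by split=> //=; exact: s_mem.
  by exists q0; rewrite /= !sK.
by split; apply/key; rewrite ?sK.
Qed.

Variable a : G.
Hypotheses (Aa : A a) (da : dpred (X := GG) (fun x => x = a)).

Let rel z := exists k, relk k z.

Let dpred_rel : dpred rel.
Proof. exact: (dpred_exists_nat oM). Qed.

(** The ring of [cyclic_ring] for the action of [H], at the point [p a]. Only the operators [g - 1],
    that is [act g - act 1], are recorded, since commutators involve no others. *)
Lemma section_ring : exists (R : interpretable_ring M) (i : R -> V),
  [/\ injective i, forall x y, i (x + y) = i x + i y,
      forall g, H g -> exists r, i r = p (a ^ g)%g - p a,
      forall g x y, H g -> i x = p (a ^ g)%g - p a ->
        i (rng_mul x y) = p (s (i y) ^ g)%g - i y
    & rng_commutative R].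
Proof.
have [R [i [i_inj iD iW iM RC]]] := cyclic_ring O_add O_comp O_comm (p a).
have OB g : H g -> sumop O 1 (fun x => act g x - act 1%g x).
  move=> hg; exists (fun=> 0), (act g), (act 1%g); split=> //.
  - by exists g.
  - by exists 1%g.
  - by apply/funext => x; rewrite add0r.
suff [R' e] : exists R' : interpretable_ring M, dr_rng R' = R.
  subst R; exists R', i; split=> //.
    move=> g hg; apply/iW; exists 1%N, (fun x => act g x - act 1%g x).
    by split; [exact: OB|rewrite act1 actE].
  move=> g x y hg e; rewrite (iM _ _ x y (OB g hg)) ?act1 ?actE //.
pose eqX (x y : GG) := (A x /\ A y) /\ B (x^-1 * y)%g.
have eqXE x y : eqX x y <-> [/\ A x, A y & p x = p y].
  split=> [[[h1 h2] h3]|[h1 h2 h3]]; first by split=> //; apply/pE.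
  by split=> //; apply/pE.
have lE r x : eqX (s (i r)) x <-> A x /\ p x = i r.
  rewrite eqXE sK; split=> [[]//|[h ->]]; by split=> //; exact: s_mem.
(* Repeating the pair turns [rel] into membership in the orbit of [a]. *)
have WP x : A x -> (exists r, p x = i r) <-> rel ((a, x), (a, x)).
  move=> hx; have := iW (p x); split=> [[r e]|[k [_ [q [/= hq e _]]]]].
    have [|k [q [hq e']]] := proj1 (iW (p x)); first by exists r.
    by exists k; split=> //; exists q.
  by have [r e'] := proj2 (iW (p x)) (ex_intro _ k (ex_intro _ q (conj hq e))); exists r.
have dW : dpred (fun x : GG => exists r, eqX (s (i r)) x).
  apply: (dpred_iff (P := fun x : GG => A x /\ exists c : GG, c = a /\ rel ((c, x), (c, x)))).
    apply: dpred_and => //; apply: dpred_ex; apply: dpred_and.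
      by apply: (dpred_comp (P := fun c : GG => c = a)) => //; dterm.
    by apply: dpred_comp dpred_rel; dterm.
  move=> x; split=> [[hx [c [-> /(WP _ hx)[r e]]]]|[r /lE[hx e]]].
    by exists r; apply/lE.
  by split=> //; exists a; split=> //; apply/(WP _ hx); exists r.
apply: (@interpretable_quotient _ _ _ _ _ GG eqX _ _ _ R (fun r => s (i r))) => //.
- apply: dpred_and; last by apply: (dpred_mem (K := B)) => //; dterm.
  by apply: dpred_and; apply: (dpred_mem (K := A)) => //; dterm.
- by move=> x y /eqXE[? ? e]; apply/eqXE.
- by move=> x y z /eqXE[? ? e] /eqXE[? ? e']; apply/eqXE; rewrite e.
- by move=> r; apply/lE; rewrite sK; split=> //; exact: s_mem.
- by move=> r t /lE[_]; rewrite sK => /i_inj.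
- apply: (dpred_iff (P := fun z : dprod (dprod GG GG) GG =>
    ((exists r, eqX (s (i r)) z.1.1) /\ (exists r, eqX (s (i r)) z.1.2)) /\
    (A z.2 /\ B (z.2^-1 * (z.1.1 * z.1.2))%g))).
    apply: dpred_and.
      by apply: dpred_and; apply: (dpred_comp (P := fun x : GG => exists r, eqX (s (i r)) x)) => //;
        dterm.
    by apply: dpred_and; [apply: (dpred_mem (K := A))|apply: (dpred_mem (K := B))] => //; dterm.
  case=> -[x y] z /=; split=> [[[[r hr] [t ht]] [hz hB]]|[r [t [hr ht hz]]]].
    exists r, t; split=> //; apply/lE; split=> //.
    move: hr ht => /lE[hx ex] /lE[hy ey].
    by rewrite iD -ex -ey -pM //; apply/pE => //; exact: AM.
  split; first by split; [exists r|exists t].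
  move: hr ht hz => /lE[hx ex] /lE[hy ey] /lE[hz ez]; split=> //.
  by apply/pE; [|exact: AM|rewrite ez iD -ex -ey -pM].
- apply: (dpred_iff (P := fun z : dprod (dprod GG GG) GG =>
    ((exists r, eqX (s (i r)) z.1.1) /\ (exists r, eqX (s (i r)) z.1.2)) /\
    (A z.2 /\ exists c : GG, c = a /\ rel ((c, z.1.1), (z.1.2, z.2))))).
    apply: dpred_and.
      by apply: dpred_and; apply: (dpred_comp (P := fun x : GG => exists r, eqX (s (i r)) x)) => //;
        dterm.
    apply: dpred_and; first by apply: (dpred_mem (K := A)) => //; dterm.
    apply: dpred_ex; apply: dpred_and.
      by apply: (dpred_comp (P := fun c : GG => c = a)) => //; dterm.
    by apply: dpred_comp dpred_rel; dterm.
  case=> -[x y] z /=; split.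
    move=> [[[r hr] [t ht]] [hz [c [-> [k [_ [q [/= hq e1 e2]]]]]]]].
    exists r, t; split=> //; apply/lE; split=> //.
    move: hr ht => /lE[hx ex] /lE[hy ey].
    by rewrite (iM _ _ r t hq) -?ey ?e2 // -ex.
  move=> [r [t [hr ht hz]]].
  split; first by split; [exists r|exists t].
  move: hr ht hz => /lE[hx ex] /lE[hy ey] /lE[hz ez]; split=> //.
  exists a; split=> //.
  have [|k [q [hq e']]] := proj1 (iW (p x)); first by exists r.
  exists k; split=> //; exists q; split=> //=.
  by rewrite ez (iM _ _ r t hq) ?ey // e' ex.
Qed.

End Pointwise.

(** * Hypercentrality of abelian sections *)

Section Hypercentral.
Variables (S : signature) (M : structure S).
Hypothesis oM : omega_categorical M.
Hypothesis rings : forall R : interpretable_ring M,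
  rng_commutative R -> rng_nilpotent_by_finite R.
Variable G : definable_group M.
Implicit Types H A B K N : set G.

(** Brings a set with parameters of its own and the sets already definable over [b] under one common
    tuple. *)
Lemma extend_base (J : finType) (v : J -> sorts S) (b : tup M v)
    (base : group_base G b) K : definable_subset K ->
  exists (J' : finType) (v' : J' -> sorts S) (b' : tup M v') (base' : group_base G b'),
    dpred (X := gdtype base') K /\
    forall K', dpred (X := gdtype base) K' -> dpred (X := gdtype base') K'.
Proof.
move=> /definableP[m [w [c hK]]].
exists _, _, (pair_tuple b c).
have base' : group_base G (pair_tuple b c).
  by case: base => h1 h2; split; apply: pdef_weakenl.
exists base'; split; first exact/set_pdefP/pdef_weakenr.
by move=> K' /set_pdefP h; apply/set_pdefP; apply: pdef_weakenl.
Qed.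

Lemma definable_singleton (a : G) : definable_subset [set a].
Proof.
apply: (pdef_definable (b := dg_emb a)).
pose w := @dg_ctx _ _ G; pose w' := pair_ctx w w.
have [p hp] : foset (fun c : tup M w' => forall i, c (inl i) = c (inr i)).
  by apply: foset_forall_fin => i; exact: foset_eq (Var w' (inl i)) (Var w' (inr i)).
exists p => c; rewrite hp; split=> [h|[x -> <-] //].
by exists a => //; apply: functional_extensionality_dep => i; exact: esym (h i).
Qed.

Section Pointwise.
Variables (J : finType) (v : J -> sorts S) (b : tup M v).
Variable base : group_base G b.
Variables H A B : set G.
Hypothesis sec : abelian_section H A B.
Hypothesis cH : connected H.
Hypotheses (dH : dpred (X := gdtype base) H) (dA : dpred (X := gdtype base) A)
  (dB : dpred (X := gdtype base) B).

(* Let [J0] be a nilpotent ideal of finite index in the ring attached to [a].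
   If [g] and [h] have the same image in the ring modulo [J0], then [g^-1 * h]
   has its image in [J0]; so a stabilizer containing all [t] with image in [J0]
   has finite index, and is [H]. *)
Lemma hypercentral_pointwise a : A a -> exists n, hypercentral H A B n a.
Proof.
move=> Aa.
have [J' [v' [b' [base' [da ext]]]]] := extend_base base (definable_singleton a).
have [V [p [s [s_mem sK pM pE]]]] := quotient_zmodule (as_sA sec) (as_sB sec)
  (fun x y hx hy => as_BJ sec hx (as_AH sec hy)) (as_AB sec) (as_BA sec).
have [R [i [i_inj iD iO iM RC]]] := section_ring oM sec (ext _ dH) (ext _ dA) (ext _ dB)
  s_mem sK pM pE Aa da.
have [J0 [[J00 JB JI] [k Jk] fJ]] := rings RC.
have [H1 HM HV] := as_sH sec; have [A1 AM AV] := as_sA sec.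
have AJ := as_AJ sec.
have JD x y : J0 x -> J0 y -> J0 (x + y)%R.
  move=> hx hy; have := JB _ _ hx (JB _ _ J00 hy).
  by rewrite sub0r opprK.
have p1 : p 1 = 0%R by apply: (addrI (p 1)); rewrite -pM // mulg1 addr0.
have pV x : A x -> p x^-1 = (- p x)%R.
  by move=> hx; have hV := AV _ hx; apply: (addrI (p x)); rewrite -pM // mulgV p1 subrr.
have i0 : i 0%R = 0%R by apply: (addrI (i 0%R)); rewrite -iD !addr0.
have iN x : i (- x)%R = (- i x)%R by apply: (addrI (i x)); rewrite -iD !subrr.
have pR x g : A x -> H g -> p [~ x, g] = (p (x ^ g)%g - p x)%R.
  move=> hx hg; rewrite /commg pM; [|exact: AV|exact: AJ].
  by rewrite pV // addrC.
have pJ x y g : A x -> A y -> H g -> p x = p y -> p (x ^ g) = p (y ^ g).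
  move=> hx hy hg /pE h; apply/pE; [exact: AJ|exact: AJ|].
  by rewrite -conjVg -conjMg; apply: (as_BJ sec) => //; apply: h.
have [r hr] : exists r : G -> R, forall g, H g -> i (r g) = (p (a ^ g)%g - p a)%R.
  have h g : exists x, H g -> i x = (p (a ^ g)%g - p a)%R.
    have [/iO[x hx]|no] := pselect (H g); first by exists x.
    by exists 0%R.
  by have [r hr] := choice h; exists r.
have mulE g x y : H g -> A x -> p x = i y -> p (x ^ g) = (i (rng_mul (r g) y) + p x)%R.
  move=> hg hx e; rewrite (iM g _ _ hg (hr g hg)) -e.
  have -> : p (s (p x) ^ g) = p (x ^ g) by apply: pJ.
  by rewrite subrK.
have [n [f hf]] := finite_set_fin fJ.
have close g h : H g -> H h -> f (r g) = f (r h) -> J0 (r (g^-1 * h)).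
  move=> hg hh /hf e.
  have hgV := HV _ hg; have hgh := HM _ _ hgV hh.
  have [j Jj ej] : exists2 j, J0 j & (r g + j = r h)%R.
    have : [set (r g + y)%R | y in J0] (r h) by rewrite e; exists 0%R; rewrite ?addr0.
    by case=> j hj <-; exists j.
  (* With [j = (h - g) a], commutation of the action gives [(g^-1 h - 1) a = g^-1 j = (g^-1 - 1) j +
     j], which lies in the ideal. *)
  suff -> : r (g^-1 * h) = (rng_mul (r g^-1%g) j + j)%R.
    by apply: JD => //; have [] := JI (r g^-1) j Jj.
  apply: i_inj; rewrite iD hr //.
  have ij : i j = (p (a ^ h)%g - p (a ^ g)%g)%R.
    have -> : i j = (i (r h) - i (r g))%R by rewrite -ej iD addrC addKr.
    by rewrite !hr // opprB addrA subrK.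
  have hag := AJ _ _ Aa hg; have hah := AJ _ _ Aa hh.
  have hd : A (a ^ h * (a ^ g)^-1) by apply: AM => //; apply: AV.
  have ed : p (a ^ h * (a ^ g)^-1) = i j.
    by rewrite ij pM ?pV //; apply: AV.
  have := mulE _ _ _ hgV hd ed; rewrite ed => <-.
  rewrite conjMg conjVg conjgK (pM ((a ^ h) ^ g^-1) a^-1); [|exact: AJ|exact: AV].
  rewrite pV //; congr (_ - _)%R.
  rewrite -conjgM; apply/pE; [exact: AJ|by apply: AJ => //; apply: HM|].
  exact: (as_comm sec).
have step m x : A x ->
    (forall t, H t -> J0 (r t) -> hypercentral H A B m [~ x, t]) ->
    hypercentral H A B m.+1 x.
  move=> Ax h; split=> // g Hg.
  suff : [set g | H g /\ hypercentral H A B m [~ x, g]] g by case.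
  apply: cH Hg; [exact: subgroup_stabilizer|exact: (definable_stabilizer (base := base))| |].
    by move=> ? [].
  exists n, (f \o r) => g1 g2 h1 h2 /(close _ _ h1 h2) hJ.
  have h12 : H (g1^-1 * g2) by apply: HM => //; apply: HV.
  by split=> //; apply: h.
(* Each commutator with some [t] such that [r t] is in [J0] multiplies by one more element of [J0].
   Since [products J0 k] has [k.+1] factors and vanishes, an element coming from [k - m + 1] factors
   is at level [m]. *)
have main m x y : m <= k -> A x -> products J0 (k - m) y -> p x = i y ->
    hypercentral H A B m x.
  elim: m x y => [|m IH] x y le Ax.
    rewrite subn0 => /Jk -> ; rewrite i0 -p1 => /pE h /=.
    have [_ _ BV] := as_sB sec.
    by have := BV _ (h Ax A1); rewrite mulg1 invgK.
  move=> hy e; apply: step => // t Ht Jt.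
  apply: (IH _ (rng_mul y (r t))); first exact: ltnW.
  - by rewrite /commg; apply: AM; [exact: AV|exact: AJ].
  - by rewrite -(subnSK le) /=; exists y => //; exists (r t).
  - by rewrite pR // (mulE _ _ _ Ht Ax e) addrK RC.
(* The ring has no unit in general and [p a] need not come from it, so one extra commutator is spent
   to pass from [a] to the image of [J0]. *)
exists k.+1; apply: step => // t Ht Jt.
apply: (main k _ (r t)) => //.
- by rewrite /commg; apply: AM; [exact: AV|exact: AJ].
- by rewrite subnn.
- by rewrite pR // hr.
Qed.

Lemma hypercentral_mono n : hypercentral H A B n `<=` hypercentral H A B n.+1.
Proof.
have [_ BM BV] := as_sB sec.
elim: n => [|n IH] x /=.
  move=> hx; split=> [|g hg]; first exact: (as_BA sec).
  by rewrite /commg; apply: BM; [exact: BV|exact: (as_BJ sec)].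
by move=> [hx h]; split=> // g hg; apply/IH/h.
Qed.

Lemma hypercentral_uniform : exists n, A `<=` hypercentral H A B n.
Proof.
have [n hn] := dpred_cover oM (fun k => dpred_hypercentral dH dA dB k).
exists n => x /hypercentral_pointwise[k /hn[j /ltnW le hj]].
by rewrite -(subnK le); elim: (n - j)%N => //= m IH; apply: hypercentral_mono.
Qed.

End Pointwise.
End Hypercentral.

(** * Solvable groups *)

Section Commutators.
Variable T : groupType.
Implicit Types A B H : set T.

Lemma mem_commutator A B x y : A x -> B y -> commutator_subgroup A B [~ x, y].
Proof. by move=> hx hy; apply: sub_gen_smallest; exists x => //; exists y. Qed.

Lemma commutator_sub A B H : subgroup H ->
  (forall x y, A x -> B y -> H [~ x, y]) -> commutator_subgroup A B `<=` H.
Proof.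
by move=> sH h; apply: smallest_sub => // _ [x hx [y hy <-]]; apply: h.
Qed.

Lemma commutator_conj A B H :
  (forall x g, A x -> H g -> A (x ^ g)) -> (forall x g, B x -> H g -> B (x ^ g)) ->
  forall x g, commutator_subgroup A B x -> H g -> commutator_subgroup A B (x ^ g).
Proof.
move=> AJ BJ x g hx hg; move: x hx.
have [C1 CM CV] := subgroup_smallest [set [~ x, y] | x in A & y in B].
have h : subgroup [set x | commutator_subgroup A B (x ^ g)].
  split=> [|x y|x] /=; rewrite ?conj1g ?conjMg ?conjVg //; first exact: CM.
  exact: CV.
apply: (commutator_sub h) => x y hx hy /=.
by rewrite conjRg; apply: mem_commutator; [apply: AJ|apply: BJ].
Qed.

Lemma lower_centralP N H i : subgroup N -> N `<=` H ->
  (forall x g, N x -> H g -> N (x ^ g)) ->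
  [/\ subgroup (lower_central N i), lower_central N i `<=` N
    & forall x g, lower_central N i x -> H g -> lower_central N i (x ^ g)].
Proof.
move=> sN NH NJ; have [N1 NM NV] := sN.
elim: i => [|i [sL LN LJ]]; first by split.
split; first exact: subgroup_smallest.
  apply: commutator_sub => // x y /LN hx hy.
  by rewrite /commg; apply: NM; [exact: NV|exact/NJ/NH].
exact: commutator_conj.
Qed.

Lemma derived_commutator H k :
  derived_series (commutator_subgroup H H) k = derived_series H k.+1.
Proof. by elim: k => //= k ->. Qed.

Lemma derived_mono H H' k : H `<=` H' -> derived_series H k `<=` derived_series H' k.
Proof.
move=> sub; elim: k => //= k IH; apply: commutator_sub; first exact: subgroup_smallest.
by move=> x y /IH hx /IH hy; apply: mem_commutator.
Qed.

(** Each further commutator with [H] descends one level of the hypercentral series. *)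
Lemma lower_central_hypercentral H A B k i : abelian_section H A B ->
  lower_central H i `<=` hypercentral H A B k -> lower_central H (i + k) `<=` B.
Proof.
move=> sec; elim: k i => [|k IH] i h; first by rewrite addn0.
rewrite addnS -addSn; apply: IH; apply: commutator_sub => [|x y /h[_ hx] /hx//].
by have [] := hypercentralP sec k.
Qed.

(** An element of [H'] is coloured by its colour modulo [H] together with the colour, modulo [K], of
    its translate into [H] by a chosen element of the same first colour. *)
Lemma fin_idx_trans K H H' : fin_idx K H -> fin_idx H H' -> fin_idx K H'.
Proof.
move=> [n [f hf]] [m [f' hf']].
have h i : exists r, forall x, H' x -> f' x = i -> H' r /\ f' r = i.
  have [[r hr]|no] := pselect (exists r, H' r /\ f' r = i); first by exists r.
  by exists 1 => x hx e; case: no; exists x.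
have [r {}h] := choice h.
pose F x : 'I_m * 'I_n := (f' x, f ((r (f' x))^-1 * x)).
exists #|{: 'I_m * 'I_n}|, (fun x => enum_rank (F x)) => x y hx hy.
move=> /enum_rank_inj[e1]; rewrite -e1 => e2.
have [hr er] := h _ x hx erefl.
have hrx : H ((r (f' x))^-1 * x) by apply: hf'.
have hry : H ((r (f' x))^-1 * y) by apply: hf' => //; rewrite er.
by have := hf _ _ hrx hry e2; rewrite invgM invgK -mulgA mulVKg.
Qed.

End Commutators.

(** * Nilpotency of connected solvable groups *)

Section Solvable.
Variables (S : signature) (M : structure S).
Hypothesis oM : omega_categorical M.
Hypothesis cc : forall G' : definable_group M, has_connected_component G'.
Hypothesis rings : forall R : interpretable_ring M,
  rng_commutative R -> rng_nilpotent_by_finite R.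
Variable G : definable_group M.
Implicit Types H A B K N : set G.

(** Normality comes from minimality: the elements of [H] that [g] conjugates into [N] form another
    definable subgroup of finite index in [H]. *)
Lemma component_conj (J : finType) (v : J -> sorts S) (b : tup M v)
    (base : group_base G b) N H g : subgroup H -> dpred (X := gdtype base) H ->
  component_of N H ->
  (forall x, H x -> H (x ^ g)) -> forall x, N x -> N (x ^ g).
Proof.
move=> [H1 HM HV] dH [[N1 NM NV] NH dN [n [f hf]] minN] HJ x Nx.
suff : [set x | H x /\ N (x ^ g)] x by case.
apply: minN Nx.
- split=> [|y z [hy ny] [hz nz]|y [hy ny]] /=; first by rewrite conj1g.
    by split; [exact: HM|rewrite conjMg; exact: NM].
  by split; [exact: HV|rewrite conjVg; exact: NV].
- have [J' [v' [b' [base' [dN' ext]]]]] := extend_base base dN.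
  apply: (definable_section (base := base') (P := fun x g => H x /\ N (x ^ g))).
  apply: dpred_and; first by apply: (dpred_mem (K := H)) (ext _ dH); dterm.
  by apply: (dpred_mem (K := N)) => //; dterm.
- by move=> y [].
- exists n, (fun y => f (y ^ g)) => y z hy hz e; split.
    by apply: HM => //; apply: HV.
  by rewrite conjMg conjVg; apply: hf => //; apply: HJ.
Qed.

(* For [q] in [H] the centralizer of [q] modulo [N], the component of [[H, H]],
   is definable of finite index in [H], hence is [H]: so [[H, H] <= N]. *)
Lemma connected_commutator (J : finType) (v : J -> sorts S) (b : tup M v)
    (base : group_base G b) H : subgroup H -> dpred (X := gdtype base) H ->
  connected H -> connected (commutator_subgroup H H).
Proof.
move=> sH dH cH; have [H1 HM HV] := sH.
pose D := commutator_subgroup H H.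
have dD : dpred (X := gdtype base) D by apply: dpred_commutator.
have sD : subgroup D by apply: subgroup_smallest.
have HJ x g : H x -> H g -> H (x ^ g).
  by move=> hx hg; rewrite /conjg; apply: (HM); [exact: HV|exact: HM].
have DJ : forall x g, D x -> H g -> D (x ^ g) by apply: commutator_conj.
have [N compN] := connected_component cc sD dD.
have NJ x g : N x -> H g -> N (x ^ g).
  by move=> hx hg; apply: (component_conj sD dD compN) hx => y /DJ; apply.
have [sN ND dN [n [f hf]] minN] := compN; have [N1 NM NV] := sN.
suff DN : D `<=` N.
  by move=> K sK dK KD fK; apply: subset_trans DN _; apply: minN.
apply: commutator_sub => // q g hq hg.
suff : [set g | H g /\ N [~ q, g]] g by case.
have KV x : H x -> N [~ q, x] -> N [~ q, x^-1].
  by move=> hx nx; rewrite commgV_r; apply: NJ; [exact: NV|exact: HV].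
apply: cH hg.
- split=> [|x y [hx nx] [hy ny]|x [hx nx]] /=; first by rewrite commg1.
    by split; [exact: HM|rewrite commgM_r; apply: NM => //; apply: NJ].
  by split; [exact: HV|exact: KV].
- have [J' [v' [b' [base' [dN' ext]]]]] := extend_base base dN.
  apply: (definable_section (base := base') (P := fun g q => H g /\ N [~ q, g])).
  apply: dpred_and; first by apply: (dpred_mem (K := H)) (ext _ dH); dterm.
  by apply: (dpred_mem (K := N)) => //; dterm.
- by move=> x [].
(* All commutators [[~ q, x^-1]] lie in [D], which [f] colours modulo [N]. The inverses suit left
   cosets: the quotient of two such commutators is a conjugate of [[~ q, y^-1 * x]], and [y^-1 * x]
   is the inverse of [x^-1 * y]. *)
- exists n, (fun x => f [~ q, x^-1]) => x y hx hy e.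
  have hxV := HV _ hx; have hyV := HV _ hy.
  have : N ([~ q, x^-1]^-1 * [~ q, y^-1]) by apply: hf => //; apply: mem_commutator.
  have -> : [~ q, x^-1]^-1 * [~ q, y^-1] = [~ q, y^-1 * x] ^ x^-1.
    by rewrite /commg /conjg !invgM !invgK -!mulgA ?mulKg ?mulVKg ?mulgV ?mulg1.
  move=> /NJ/(_ hx); rewrite conjgKV => h.
  have hyx : H (y^-1 * x) by apply: HM.
  split; first exact: HM.
  by have := KV _ hyx h; rewrite invgM invgK.
Qed.

Lemma connected_solvable_nilpotent k H : subgroup H -> definable_subset H ->
  connected H -> derived_series H k `<=` [set 1] ->
  exists m, lower_central H m `<=` [set 1].
Proof.
elim: k H => [|k IH] H sH defH cH hk; first by exists 0%N.
have [m0 [v0 [b0 base0]]] := exists_group_base G.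
have [J [v [b [base [dH _]]]]] := extend_base base0 defH.
have [H1 HM HV] := sH.
pose D := commutator_subgroup H H.
have dD : dpred (X := gdtype base) D by apply: dpred_commutator.
have sD : subgroup D by apply: subgroup_smallest.
have HJ x g : H x -> H g -> H (x ^ g).
  by move=> hx hg; rewrite /conjg; apply: (HM); [exact: HV|exact: HM].
have DJ : forall x g, D x -> H g -> D (x ^ g) by apply: commutator_conj.
have DH : D `<=` H.
  apply: commutator_sub => // x y hx hy.
  by rewrite /commg; apply: HM; [exact: HV|exact: HJ].
have [||||m hm] := IH D => //; first exact: dpred_definable dD.
- exact: connected_commutator dH cH.
- by rewrite derived_commutator.
pose L := lower_central D.
have LP i := lower_centralP i sD DH DJ.
have dL i : dpred (X := gdtype base) (L i).
  by elim: i => // i hi; apply: dpred_commutator.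
have sec i : abelian_section H (L i) (L i.+1).
  have [sL LD LJ] := LP i; have [sL' LD' LJ'] := LP i.+1.
  have [L1 LM LV] := sL.
  split=> //.
  - by move=> x /LD/DH.
  - apply: commutator_sub => // x y hx /DH hy.
    by rewrite /commg; apply: LM; [exact: LV|exact: LJ].
  - by move=> x y hx /LD hy; apply: mem_commutator.
  (* The action is abelian because [h * g] and [g * h] differ by an element of [D], and commutators
     of [L i] with [D] fall into [L i.+1]. *)
  - move=> x g h hx hg hh; rewrite (commgC h g) (conjgM x (g * h)).
    apply: mem_commutator; last exact: mem_commutator.
    by apply: LJ => //; apply: HM.
suff [i hi] : exists i, lower_central H i `<=` L m.
  by exists i; apply: subset_trans hi hm.
(* The induction starts at [1] because [lower_central H 1] is [D], that is [L 0]; each factor of the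
   series [L] then costs its hypercentral length. *)
elim: m {hm} => [|m [i hi]]; first by exists 1%N.
have [n hn] := hypercentral_uniform oM rings (sec m) cH dH (dL m) (dL m.+1).
exists (i + n); apply: lower_central_hypercentral (sec m) _.
exact: subset_trans hi hn.
Qed.

Lemma solvable_nilpotent_by_finite : group_solvable G -> group_nilpotent_by_finite G.
Proof.
move=> [k hk].
have [m0 [v0 [b0 base]]] := exists_group_base G.
have sT : subgroup [set: G] by split.
have dT : dpred (X := gdtype base) [set: G] by apply: dpred_true.
have [N compN] := connected_component cc sT dT.
have [sN _ dN fN minN] := compN.
have cN : connected N.
  by move=> K sK dK KN fK; apply: minN => //; apply: fin_idx_trans fK fN.
have [|m hm] := connected_solvable_nilpotent (k := k) sN dN cN.
  by rewrite -hk; apply: derived_mono.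
exists N; split=> //; last exact/finite_index_fin_idx.
  by move=> x y; apply: (component_conj sT dT compN).
exists m; apply/seteqP; split=> // _ ->.
have NN : N `<=` N by [].
have [|[]//] := lower_centralP m sN NN.
have [N1 NM NV] := sN.
by move=> x g hx hg; rewrite /conjg; apply: (NM); [exact: NV|exact: NM].
Qed.

End Solvable.

(* The second conjunct is the parenthetical strengthening: it suffices that the
   commutative interpretable rings are nilpotent-by-finite. *)
Theorem theorem4p15 (S : signature) (M : structure S) :
  omega_categorical M ->
  (forall G : definable_group M, has_connected_component G) ->
  ((forall R : interpretable_ring M, rng_nilpotent_by_finite R) ->
   forall G : definable_group M, group_solvable G -> group_nilpotent_by_finite G) /\
  ((forall R : interpretable_ring M,
      rng_commutative R -> rng_nilpotent_by_finite R) ->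
   forall G : definable_group M, group_solvable G -> group_nilpotent_by_finite G).
Proof.
by move=> oM cc; split=> rings G; apply: solvable_nilpotent_by_finite => // R _.
Qed.
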